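(* Let $1<p<\infty$, let $(a,b)$ be a matching pair with subordinated pair $(c,d)$, and suppose that $T(c)$ and $T(d)$ are Fredholm on $H^p$ with indices $\kappa_c=\kappa_1=\mathrm{ind}\,T(c)$ and $\kappa_d=\kappa_2=\mathrm{ind}\,T(d)$. If $\kappa_c\ge 0$ and $\kappa_d\ge 0$, then for any $f\in H^p$ the equation $(T(a)+H(b))\varphi=f$ is solvable in $H^p$, and all solutions of this equation are given by the formula $$\varphi=T_r^{-1}(c)T(\widetilde a^{-1})T_r^{-1}(d)f-JQc\,T_r^{-1}(c)T(\widetilde a^{-1})T_r^{-1}(d)f+JQ\widetilde a^{-1}T_r^{-1}(d)f$$ $$\qquad+\,\mathrm{sgn}(\kappa_c)\,c_+^{-1}\sum_{k=0}^{\kappa(1)}r_k^{(1)}u_k^{(\kappa(1),-)}+\mathrm{sgn}(\kappa_d)\,W\Big(d_+^{-1}\sum_{k=0}^{\kappa(2)}r_k^{(2)}u_k^{(\kappa(2),+)}\Big),$$ where $r_k^{(i)}$, $k=0,1,\dots,\kappa(i)$, $i=1,2$, are arbitrary complex numbers. Here, with $s_1=c$, $s_2=d$, for $i=1,2$: $$\kappa(i)=m_i-1,\quad u_k^{(\kappa(i),\pm)}(t)=t^{m_i-k-1}\pm\boldsymbol{\sigma}(s_i)\,t^{m_i+k}\qquad\text{if }\kappa_i=2m_i,$$ $$\kappa(i)=m_i,\quad u_k^{(\kappa(i),\pm)}(t)=t^{m_i+k}\pm\boldsymbol{\sigma}(s_i)\,t^{m_i-k}\qquad\text{if }\kappa_i=2m_i+1,$$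 and $\mathrm{sgn}(r)=0$ if $r=0$, $\mathrm{sgn}(r)=1$ if $r>0$.
   Context: Let $\mathbb{T}$ be the unit circle, $1<p<\infty$, $1/p+1/q=1$, $L^p=L^p(\mathbb{T})$, $H^p=\{f\in L^p:\widehat f_n=0\ \forall n<0\}$, $\overline{H^p}=\{f\in L^p:\widehat f_n=0\ \forall n>0\}$. $P:\sum_{n\in\mathbb{Z}}\widehat f_nt^n\mapsto\sum_{n\ge0}\widehat f_nt^n$ is the Riesz projection on $L^p$, $Q=I-P$, and $(Jf)(t)=t^{-1}f(t^{-1})$. For $g\in L^\infty$: $\widetilde g(t)=g(1/t)$; $T(g)=PgP$ and $H(g)=PgQJ$ on $H^p$ are the Toeplitz and Hankel operators. Matching pair: $a,b\in L^\infty$, $a$ (and hence $b$) invertible in $L^\infty$, with $a\widetilde a=b\widetilde b$ on $\mathbb{T}$. Its subordinated pair is $(c,d)$ with $c=ab^{-1}=\widetilde b\,\widetilde a^{-1}$ and $d=b\,\widetilde a^{-1}=\widetilde b^{-1}a$; one has $c\widetilde c=1=d\widetilde d$. Wiener--Hopf factorization: for $g\in L^\infty$ with $T(g)$ Fredholm on $H^p$, there is a unique factorization $g=g_-t^ng_+$ with $n=-\mathrm{ind}\,T(g)$, $g_+\in H^q$, $g_+^{-1}\in H^p$, $g_-\in\overline{H^p}$, $g_-^{-1}\in\overline{H^q}$, $g_-(\infty)=1$ (zeroth Fourier coefficient of $g_-$ equal to $1$), such that $g_+^{-1}Pg_-^{-1}I$, defined on polynomials, extends to a bounded operator on $H^p$,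 denoted $T(g_+^{-1})T(g_-^{-1})$. The functions $c_\pm,d_\pm$ are the factors in these factorizations of $c$ and $d$. If $g\widetilde g=1$, it is known that $g_-=\boldsymbol{\sigma}(g)\,\widetilde g_+^{-1}$, where $\boldsymbol{\sigma}(g):=g_+(0)=\pm1$ is the factorization signature. If $n\le0$ (i.e. $\mathrm{ind}\,T(g)\ge0$), $T_r^{-1}(g):=T(g_+^{-1})T(g_-^{-1})T(t^{-n})$, a right inverse of $T(g)$ on $H^p$. When $T(c)$ is right invertible, $W$ is the operator on $H^p$ $$W\varphi:=T_r^{-1}(c)T(\widetilde a^{-1})\varphi-JQcP\,T_r^{-1}(c)T(\widetilde a^{-1})\varphi+JQ\widetilde a^{-1}\varphi .$$ If $\kappa_i=0$, then $\kappa(i)=-1$ and the corresponding sum is empty. *)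

(* Defs.v *)
From HB Require Import structures.
From mathcomp Require Import all_boot all_order all_algebra.
From mathcomp Require Import complex.
From mathcomp Require Import all_classical all_reals all_analysis.
Set Implicit Arguments.
Unset Strict Implicit.
Unset Printing Implicit Defensive.
Import Order.TTheory GRing.Theory Num.Theory.
Import numFieldNormedType.Exports.
Local Open Scope ring_scope.
Local Open Scope complex_scope.
Local Open Scope classical_set_scope.

(* A function on the unit circle is represented by a total function           *)
(* R[i] -> R[i], of which only the values at the points cis x = e^{ix} are    *)
(* ever used; thus 1/t, t^n and t^{-1} f(t^{-1}) are literal field            *)
(* expressions. Equality of elements of L^p is equality almost everywhere.    *)

Section circle.
Context {R : realType}.

Definition cfun : Type := R[i] -> R[i].
Implicit Types f g : cfun.

Definition cis (x : R) : R[i] := (cos x +i* sin x)%C.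

Fact two_pi_gt0 : (0 : R) < 2 * pi.
Proof. by rewrite mulr_gt0 ?pi_gt0. Qed.

(* normalized arc length, in the angle coordinate *)
Definition arc := uniform_prob two_pi_gt0.

Definition ae_circle f g : Prop := {ae arc, forall x, f (cis x) = g (cis x)}.

Definition Lp_norm (r : \bar R) f : \bar R :=
  Lnorm arc r (fun x => (ComplexField.Normc.normc (f (cis x)))%:E).

Definition Lp (r : \bar R) f : Prop :=
  [/\ measurable_fun setT (fun x => complex.Re (f (cis x))),
      measurable_fun setT (fun x => complex.Im (f (cis x)))
    & (Lp_norm r f < +oo)%E].

Definition cmean f : R[i] :=
  Rintegral arc setT (fun x => complex.Re (f (cis x))) +i*
  Rintegral arc setT (fun x => complex.Im (f (cis x))).

Definition fourier f (n : int) : R[i] := cmean (fun t => f t * t ^ (- n)).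

Definition Hp (r : R) f : Prop :=
  Lp r%:E f /\ forall n : int, n < 0 -> fourier f n = 0.

Definition Hp_bar (r : R) f : Prop :=
  Lp r%:E f /\ forall n : int, 0 < n -> fourier f n = 0.

Definition cone : cfun := fun=> 1.
Definition czero : cfun := fun=> 0.
Definition cinv f : cfun := fun t => (f t)^-1.
Definition cpow (n : int) : cfun := fun t => t ^ n.
Definition cscale (z : R[i]) f : cfun := fun t => z * f t.
Definition lincomb n (z : 'I_n -> R[i]) (u : 'I_n -> cfun) : cfun :=
  fun t => \sum_(i < n) z i * u i t.

Definition tilde f : cfun := fun t => f t^-1.
Definition flip f : cfun := fun t => t^-1 * f t^-1.

(* P is required on every L^r, 1 < r < oo, since g_-^{-1} times a polynomial  *)
(* lies in L^q, not in L^p. The condition determines P f almost everywhere.   *)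
Definition riesz_projection (P : cfun -> cfun) : Prop :=
  forall (r : R) f, 1 < r -> Lp r%:E f ->
    Lp r%:E (P f) /\
    forall n : int, fourier (P f) n = if 0 <= n then fourier f n else 0.

Definition bounded_operator (p : R) (A : cfun -> cfun) : Prop :=
  [/\ forall f, Hp p f -> Hp p (A f),
      forall z f g, Hp p f -> Hp p g ->
        ae_circle (A (cscale z f \+ g)) (cscale z (A f) \+ A g)
    & exists M : R, forall f, Hp p f ->
        (Lp_norm p%:E (A f) <= M%:E * Lp_norm p%:E f)%E].

Definition ker_dim (p : R) (A : cfun -> cfun) (n : nat) : Prop :=
  exists u : 'I_n -> cfun,
    [/\ forall i, Hp p (u i) /\ ae_circle (A (u i)) czero,
        forall z : 'I_n -> R[i],
          ae_circle (lincomb z u) czero -> forall i, z i = 0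
      & forall f, Hp p f -> ae_circle (A f) czero ->
          exists z : 'I_n -> R[i], ae_circle f (lincomb z u)].

(* the classes of the v j form a basis of H^p / A(H^p) *)
Definition coker_dim (p : R) (A : cfun -> cfun) (n : nat) : Prop :=
  exists v : 'I_n -> cfun,
    [/\ forall j, Hp p (v j),
        forall (f : cfun) (z : 'I_n -> R[i]), Hp p f ->
          ae_circle (A f) (lincomb z v) -> forall j, z j = 0
      & forall g, Hp p g -> exists (f : cfun) (z : 'I_n -> R[i]),
          Hp p f /\ ae_circle g (A f \+ lincomb z v)].

(* The range of a bounded operator with finite-dimensional cokernel is closed *)
(* automatically.                                                             *)
Definition fredholm_index (p : R) (A : cfun -> cfun) (k : int) : Prop :=
  bounded_operator p A /\
  exists m n : nat, [/\ ker_dim p A m, coker_dim p A n & k = m%:Z - n%:Z].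

Definition matching_pair (a b : cfun) : Prop :=
  [/\ Lp +oo%E a, Lp +oo%E b,
      Lp +oo%E (cinv a) /\ ae_circle (a \* cinv a) cone
    & ae_circle (a \* tilde a) (b \* tilde b)].

Definition sub_c (a b : cfun) : cfun := a \* cinv b.
Definition sub_d (a b : cfun) : cfun := b \* cinv (tilde a).

Section operators.
Variable P : cfun -> cfun.

Definition Qproj f : cfun := f \- P f.
Definition toeplitz g f : cfun := P (g \* P f).
Definition hankel g f : cfun := P (g \* Qproj (flip f)).

(* g = g_- t^n g_+; wh_ext is the operator T(g_+^{-1}) T(g_-^{-1}), i.e. the  *)
(* bounded extension to H^p of g_+^{-1} P g_-^{-1} I.                         *)
Record wh_factorization (p q : R) (g : cfun) (n : int) := WHFactorization {
  wh_minus : cfun;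
  wh_plus : cfun;
  wh_ext : cfun -> cfun;
  wh_eq : ae_circle g (wh_minus \* cpow n \* wh_plus);
  wh_plus_Hq : Hp q wh_plus;
  wh_plusV_Hp : Hp p (cinv wh_plus);
  wh_plusV : ae_circle (wh_plus \* cinv wh_plus) cone;
  wh_minus_Hp : Hp_bar p wh_minus;
  wh_minusV_Hq : Hp_bar q (cinv wh_minus);
  wh_minusV : ae_circle (wh_minus \* cinv wh_minus) cone;
  wh_minus_infty : fourier wh_minus 0 = 1;
  wh_ext_bounded : bounded_operator p wh_ext;
  wh_ext_poly : forall s : {poly R[i]},
    ae_circle (wh_ext (horner s))
              (cinv wh_plus \* P (cinv wh_minus \* horner s)) }.

Section factorized.
Context {p q : R} {g : cfun} {n : int}.
Variable F : wh_factorization p q g n.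

(* the signature g_+(0) *)
Definition signature : R[i] := fourier (wh_plus F) 0.

(* meaningful for n <= 0 *)
Definition Tr_inv f : cfun := wh_ext F (toeplitz (cpow (- n)) f).

End factorized.

Definition Wop (p q : R) (a c : cfun) (n : int)
    (Fc : wh_factorization p q c n) f : cfun :=
  Tr_inv Fc (toeplitz (cinv (tilde a)) f)
  \- flip (Qproj (c \* P (Tr_inv Fc (toeplitz (cinv (tilde a)) f))))
  \+ flip (Qproj (cinv (tilde a) \* f)).

End operators.

(* nb_terms k is kappa(i) + 1 for kappa_i = k: m if k = 2m, m + 1 if k = 2m+1 *)
Definition nb_terms (k : nat) : nat := if odd k then k./2.+1 else k./2.

(* e = 1, -1 gives u^{(.,+)}, u^{(.,-)}; s is the signature *)
Definition ufun (e s : R[i]) (k j : nat) : cfun := fun t =>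
  let m := k./2 in
  if odd k then t ^+ (m + j) + e * s * t ^+ (m - j)
  else t ^+ (m - j - 1) + e * s * t ^+ (m + j).

Definition usum (e s : R[i]) (k : nat) (r : 'I_(nb_terms k) -> R[i]) : cfun :=
  lincomb r (fun j => ufun e s k j).

Section solution.
Variables (P : cfun -> cfun) (p q : R) (a b : cfun) (kc kd : int).
Variables (Fc : wh_factorization P p q (sub_c a b) (- kc))
          (Fd : wh_factorization P p q (sub_d a b) (- kd)).

Definition solution f (r1 : 'I_(nb_terms `|kc|) -> R[i])
    (r2 : 'I_(nb_terms `|kd|) -> R[i]) : cfun :=
  Tr_inv Fc (toeplitz P (cinv (tilde a)) (Tr_inv Fd f))
  \- flip (Qproj P (sub_c a b \*
       Tr_inv Fc (toeplitz P (cinv (tilde a)) (Tr_inv Fd f))))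
  \+ flip (Qproj P (cinv (tilde a) \* Tr_inv Fd f))
  \+ cscale (sgz kc)%:~R
       (cinv (wh_plus Fc) \* usum (-1) (signature Fc) r1)
  \+ cscale (sgz kd)%:~R
       (Wop a Fc (cinv (wh_plus Fd) \* usum 1 (signature Fd) r2)).

End solution.

End circle.
Arguments cfun R : clear implicits.

(* Main.v *)
Require Import Defs.
From HB Require Import structures.
From mathcomp Require Import all_boot all_order all_algebra.
From mathcomp Require Import complex ring lra zify.
From mathcomp Require Import all_classical all_reals all_analysis.
From mathcomp Require Import measurable_realfun ess_sup_inf hoelder.
Import Defs.
Import Order.TTheory GRing.Theory Num.Theory.
Import numFieldNormedType.Exports.
Local Open Scope ring_scope.
Local Open Scope complex_scope.
Local Open Scope classical_set_scope.
Set Implicit Arguments.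
Unset Strict Implicit.
Unset Printing Implicit Defensive.

(** Write J f (t) = t^-1 f(1/t) and g~(t) = g(1/t). J is an involution that
    exchanges H^p with the functions having only negative frequencies, and
    J (g f) = g~ J f. For phi in H^p the equation (T(a) + H(b)) phi = f says that
    a phi + b J phi - f has only negative frequencies ([th_sumP]).

    Reduction to triangular form. Let psi and chi in H^p satisfy T(d) psi = f and
    T(c) chi = T(a~^-1) psi. Then the function
    phi = chi - J Q c chi + J Q a~^-1 psi is in H^p, and the matching condition
    a a~ = b b~ makes all terms in chi cancel in
    a phi + b J phi = J psi + d psi ([th_sum_particular]). Since J psi has only
    negative frequencies, phi solves the equation. The operators T_r^-1(d) and
    T_r^-1(c) provide such psi and chi: the factorization shows on polynomials
    that T(g) T_r^-1(g) = I, and both sides are bounded on H^p, where polynomials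
    are dense ([wh_ext_fourier], [fourier_Tr_inv]).

    Homogeneous solutions. The factorization also shows that the kernel of T(g)
    consists of the functions g_+^-1 u with u a polynomial of degree less than the
    index k ([wh_kernel]). If g g~ = 1, then g_- g_+~ is the constant
    s = g_+(0) with s^2 = 1 ([wh_signature]), so J (g_+^-1 u) = e g g_+^-1 u holds
    exactly when u_i = e s u_(k-1-i) ([flip_wh_poly]); such u are the combinations
    of the functions u_k^(+-) ([usum_span]). With e = -1 and g = c this gives
    solutions chi of c chi = - J chi, for which a chi + b J chi = 0; with e = 1 and
    g = d it gives psi with d psi = J psi, so that W psi is a homogeneous solution
    by the computation above. Conversely, if phi solves the homogeneous equation,
    then eta = J (a phi + b J phi) satisfies d eta = J eta, and
    chi = phi - W (eta / 2) satisfies c chi = - J chi ([homogeneous_solution]).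

    Fourier analysis. Everything above is checked on Fourier coefficients, which
    requires that an integrable function is determined by them ([fourier_inj]),
    that the spectrum of a product is controlled by the spectra of its factors
    ([fourier_prod]), and that polynomials are dense in H^p ([poly_dense]). All
    three follow from the convergence of Fejer sums in L^r, 1 <= r < oo
    ([fejer_sum_cvg]). The Fejer means are contractions of L^r ([fejer_mean_contract]),
    so convergence need only be shown for bounded continuous functions, where it
    holds pointwise because the kernel times the squared chord is O(1/n)
    ([fejer_kernel_chord]). *)

Local Notation normc := ComplexField.Normc.normc.

(** * The circle and the modulus *)

Section cis_theory.
Context {R : realType}.
Implicit Types x y : R.

Lemma cisD x y : cis (x + y) = cis x * cis y.
Proof.
rewrite /cis cosD sinD; apply/eqP.
by rewrite eq_complex /= [X in _ && (_ == X)]addrC !eqxx.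
Qed.

Lemma cis0 : cis (0 : R) = 1.
Proof. by rewrite /cis cos0 sin0. Qed.

Lemma cisMN x : cis x * cis (- x) = 1.
Proof. by rewrite -cisD subrr cis0. Qed.

Lemma cis_neq0 x : cis x != 0.
Proof.
by apply/eqP => h; have := cisMN x; rewrite h mul0r => /esym/eqP; rewrite oner_eq0.
Qed.

Lemma cisN x : cis (- x) = (cis x)^-1.
Proof. by rewrite -[RHS]mulr1 -(cisMN x) mulKf ?cis_neq0. Qed.

Lemma cis_nat x (n : nat) : cis x ^+ n = cis (n%:R * x).
Proof.
by elim: n => [|n IH]; rewrite ?expr0 ?mul0r ?cis0// exprS IH -cisD -nat1r mulrDl mul1r.
Qed.

Lemma cis_exp x (n : int) : cis x ^ n = cis (n%:~R * x).
Proof.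
case: n => n; first by rewrite -exprnP cis_nat.
by rewrite NegzE -exprnN cis_nat mulrNz mulNr cisN.
Qed.

Lemma cis_2piB x : cis (2 * pi - x) = cis (- x).
Proof.
rewrite addrC cisD [X in _ * X](_ : _ = 1) ?mulr1//.
by rewrite mulr_natl /cis cos2pi sin2pi.
Qed.

Lemma normc_cis x : normc (cis x) = 1.
Proof. by rewrite /= cos2Dsin2 sqrtr1. Qed.

End cis_theory.

Section complex_norm.
Context {R : realType}.
Implicit Types z w : R[i].

Lemma normc_ge0 z : 0 <= normc z.
Proof. by case: z => a b; exact: sqrtr_ge0. Qed.

Lemma normr_normc z : `|normc z| = normc z.
Proof. by rewrite ger0_norm ?normc_ge0. Qed.

Lemma normcB z w : normc (z - w) = normc (w - z).
Proof. by rewrite -normcN opprB. Qed.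

Lemma normc_Re z : `|complex.Re z| <= normc z.
Proof.
case: z => a b /=; rewrite -sqrtr_sqr; apply: ler_wsqrtr.
by rewrite lerDl sqr_ge0.
Qed.

Lemma normc_Im z : `|complex.Im z| <= normc z.
Proof.
case: z => a b /=; rewrite -sqrtr_sqr; apply: ler_wsqrtr.
by rewrite lerDr sqr_ge0.
Qed.

Lemma normc_le_Re_Im z : normc z <= `|complex.Re z| + `|complex.Im z|.
Proof.
case: z => a b /=; rewrite -[leRHS]ger0_norm ?addr_ge0// -sqrtr_sqr.
apply: ler_wsqrtr; rewrite sqrrD !real_normK ?num_real//.
by rewrite lerD2r lerDl mulrn_wge0 // mulr_ge0.
Qed.

Lemma normc_eq0 z : (normc z == 0) = (z == 0).
Proof.
apply/eqP/eqP => [/ComplexField.Normc.eq0_normc//|->].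
exact: ComplexField.Normc.normc0.
Qed.

End complex_norm.

(** * Measurable functions on the circle *)

Section measurability.
Context {R : realType}.
Implicit Types f g : cfun R.

(** No measurable structure is put on the complex numbers: a function on the
    circle is measurable when its two real components are. *)
Definition cmeas f :=
  measurable_fun setT (fun x => complex.Re (f (cis x))) /\
  measurable_fun setT (fun x => complex.Im (f (cis x))).

Lemma cos_measurable : measurable_fun setT (@cos R).
Proof. by apply: continuous_measurable_fun => x; exact: continuous_cos. Qed.
Lemma sin_measurable : measurable_fun setT (@sin R).
Proof. by apply: continuous_measurable_fun => x; exact: continuous_sin. Qed.

Lemma inv_measurable : measurable_fun setT (fun x : R => x^-1).
Proof.
have m0 : measurable [set (0 : R)] by exact: measurable_set1.
rewrite -(setUv [set (0 : R)]); apply/measurable_funU => //; first exact: measurableC.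
split; first exact: measurable_fun_set1.
apply: open_continuous_measurable_fun.
  by rewrite openC; apply: accessible_closed_set1; exact: hausdorff_accessible (@Rhausdorff R).
by move=> x; rewrite inE/= => /eqP x0; exact: inv_continuous.
Qed.

Lemma sqrt_measurable : measurable_fun setT (@Num.sqrt R).
Proof. by apply: continuous_measurable_fun => x; exact: sqrt_continuous. Qed.

Lemma cmeasD f g : cmeas f -> cmeas g -> cmeas (f \+ g).
Proof.
move=> [f1 f2] [g1 g2]; split.
- by under eq_fun do rewrite /= raddfD; exact: measurable_funD.
- by under eq_fun do rewrite /= raddfD; exact: measurable_funD.
Qed.

Lemma cmeasM f g : cmeas f -> cmeas g -> cmeas (f \* g).
Proof.
move=> [f1 f2] [g1 g2]; split.
- rewrite (_ : (fun _ => _) = (fun x => complex.Re (f (cis x)) * complex.Re (g (cis x))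
      - complex.Im (f (cis x)) * complex.Im (g (cis x)))); last first.
    by apply/funext => x /=; case: (f _) => ? ?; case: (g _).
  by apply: measurable_funB; exact: measurable_funM.
- rewrite (_ : (fun _ => _) = (fun x => complex.Re (f (cis x)) * complex.Im (g (cis x))
      + complex.Im (f (cis x)) * complex.Re (g (cis x)))); last first.
    by apply/funext => x /=; case: (f _) => ? ?; case: (g _).
  by apply: measurable_funD; exact: measurable_funM.
Qed.

Lemma cmeas_cst (z : R[i]) : cmeas (fun _ : R[i] => z).
Proof. by split; exact: measurable_cst. Qed.

Lemma cmeasZ (z : R[i]) f : cmeas f -> cmeas (cscale z f).
Proof. by move=> mf; apply: (@cmeasM (fun _ : R[i] => z)) => //; exact: cmeas_cst. Qed.

Lemma cmeasB f g : cmeas f -> cmeas g -> cmeas (f \- g).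
Proof.
move=> mf mg; rewrite (_ : f \- g = f \+ cscale (-1) g).
  by apply: cmeasD => //; exact: cmeasZ.
by apply/funext => t; rewrite /cscale /= mulN1r.
Qed.

Lemma cmeasV f : cmeas f -> cmeas (cinv f).
Proof.
move=> [f1 f2].
have mn : measurable_fun setT (fun x =>
    (complex.Re (f (cis x)) ^+ 2 + complex.Im (f (cis x)) ^+ 2)^-1).
  by apply: (measurableT_comp inv_measurable); apply: measurable_funD; exact: measurable_funX.
split.
- rewrite (_ : (fun _ => _) = (fun x => complex.Re (f (cis x)) *
      (complex.Re (f (cis x)) ^+ 2 + complex.Im (f (cis x)) ^+ 2)^-1)).
    exact: measurable_funM.
  by apply/funext => x /=; rewrite /cinv; case: (f _).
- rewrite (_ : (fun _ => _) = (fun x => (- complex.Im (f (cis x))) *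
      (complex.Re (f (cis x)) ^+ 2 + complex.Im (f (cis x)) ^+ 2)^-1)).
    by apply: measurable_funM => //; exact: measurableT_comp.
  by apply/funext => x /=; rewrite /cinv; case: (f _) => ? ? /=; rewrite mulNr.
Qed.

Lemma cmeas_cpow (n : int) : cmeas (cpow n).
Proof.
split.
- rewrite (_ : (fun _ => _) = (fun x => cos (n%:~R * x))).
    by apply: (measurableT_comp cos_measurable); exact: mulrl_measurable.
  by apply/funext => x /=; rewrite /cpow cis_exp.
- rewrite (_ : (fun _ => _) = (fun x => sin (n%:~R * x))).
    by apply: (measurableT_comp sin_measurable); exact: mulrl_measurable.
  by apply/funext => x /=; rewrite /cpow cis_exp.
Qed.

Lemma cmeas_tilde f : cmeas f -> cmeas (tilde f).
Proof.
move=> [f1 f2].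
have mN : measurable_fun setT (fun x : R => - x) by exact: measurableT_comp.
split.
- under eq_fun do rewrite /tilde -cisN.
  exact: (measurableT_comp f1 mN).
- under eq_fun do rewrite /tilde -cisN.
  exact: (measurableT_comp f2 mN).
Qed.

Lemma cmeas_normc f : cmeas f -> measurable_fun setT (fun x => normc (f (cis x))).
Proof.
move=> [f1 f2].
rewrite (_ : (fun _ => _) = (fun x =>
    Num.sqrt (complex.Re (f (cis x)) ^+ 2 + complex.Im (f (cis x)) ^+ 2))).
  by apply: (measurableT_comp sqrt_measurable); apply: measurable_funD; exact: measurable_funX.
by apply/funext => x; case: (f _).
Qed.

End measurability.

(** * Norms on the circle *)

Section Lnorm_ext.
Context d (T : measurableType d) (R : realType).
Variable mu : {measure set T -> \bar R}.
Implicit Types u v : T -> R.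

Lemma measurable_normr_powR u (r : R) : measurable_fun setT u ->
  measurable_fun setT (fun x => `|u x| `^ r).
Proof.
move=> mfu; apply: (measurableT_comp (@measurable_powR R r)) => //.
exact: measurableT_comp.
Qed.

Lemma LnormE u (r : R) : 'N[mu]_r%:E[EFin \o u]%E =
  ((\int[mu]_x (`|u x| `^ r)%:E) `^ r^-1)%E.
Proof. by rewrite unlock. Qed.

Lemma le_Lnorm u v (r : R) : measurable_fun setT u -> measurable_fun setT v ->
  0 < r -> {ae mu, forall x, `|u x| <= `|v x|} ->
  ('N[mu]_r%:E[EFin \o u] <= 'N[mu]_r%:E[EFin \o v])%E.
Proof.
move=> mfu mfv r0 uv; rewrite !LnormE.
have h0 w : (0 <= \int[mu]_x (`|w x| `^ r)%:E)%E.
  by apply: integral_ge0 => x _; rewrite lee_fin powR_ge0.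
apply: gt0_ler_poweR; rewrite ?in_itv/= ?leey ?h0 ?invr_ge0 ?(ltW r0)//.
apply: ae_ge0_le_integral => //.
- by apply/measurable_EFinP; exact: measurable_normr_powR.
- by apply/measurable_EFinP; exact: measurable_normr_powR.
- by apply: filterS uv => x uvx _; rewrite lee_fin ge0_ler_powR// ?nnegrE// ltW.
Qed.

Lemma LnormZl u (r a : R) : measurable_fun setT u -> 0 < r -> 0 <= a ->
  ('N[mu]_r%:E[EFin \o (fun x => a * u x)%R] = a%:E * 'N[mu]_r%:E[EFin \o u])%E.
Proof.
move=> mfu r0 a0; rewrite !LnormE.
under eq_integral do rewrite normrM powRM// EFinM (ger0_norm a0).
rewrite ge0_integralZl_EFin//; last 2 first.
- by apply/measurable_EFinP; exact: measurable_normr_powR.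
- exact: powR_ge0.
rewrite poweRM ?lee_fin ?powR_ge0//; last first.
  by apply: integral_ge0 => x _; rewrite lee_fin powR_ge0.
by rewrite poweR_EFin -powRrM mulfV ?gt_eqF// powRr1.
Qed.

End Lnorm_ext.

#[global] Instance arc_ae_filter {R : realType} :
  Filter (nbhs (almost_everywhere (@arc R))).
Proof.
exact: (@ae_filter_ringOfSetsType _ _ _ (uniform_prob (@two_pi_gt0 R))).
Qed.

Section circle_norms.
Context {R : realType}.
Implicit Types (f g : cfun R) (r : R).

Notation N r f := (Lp_norm r%:E f).

Lemma Lp_meas (r : \bar R) f : Lp r f -> cmeas f.
Proof. by case. Qed.

Lemma Lp_norm_ge0 (r : \bar R) f : (0 <= Lp_norm r f)%E.
Proof. exact: Lnorm_ge0. Qed.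

Lemma Lp_norm_le r f g : 0 < r -> cmeas f -> cmeas g ->
  {ae arc, forall x, normc (f (cis x)) <= normc (g (cis x))} -> (N r f <= N r g)%E.
Proof.
move=> r0 mf mg fg; apply: le_Lnorm => //; try exact: cmeas_normc.
by apply: filterS fg => x; rewrite !normr_normc.
Qed.

Lemma Lp_norm_ae r f g : 0 < r -> cmeas f -> cmeas g -> ae_circle f g -> N r f = N r g.
Proof.
move=> r0 mf mg fg; apply/eqP; rewrite eq_le.
by apply/andP; split; apply: Lp_norm_le => //; apply: filterS fg => x ->.
Qed.

Lemma Lp_normD r f g : 1 <= r -> cmeas f -> cmeas g ->
  (N r (f \+ g)%R <= N r f + N r g)%E.
Proof.
move=> r1 mf mg.
have mf' := cmeas_normc mf; have mg' := cmeas_normc mg.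
have r0 : 0 < r by exact: lt_le_trans r1.
apply: le_trans (minkowski_EFin arc mf' mg' r1).
apply: le_Lnorm => //; first exact: cmeas_normc (cmeasD mf mg).
  exact: measurable_funD.
apply: aeW => x; rewrite normr_normc ger0_norm ?addr_ge0 ?normc_ge0//=.
exact: le_normcD.
Qed.

Lemma Lp_normM r f g (M : R) : 0 < r -> cmeas f -> cmeas g -> 0 <= M ->
  {ae arc, forall x, normc (g (cis x)) <= M} -> (N r (g \* f)%R <= M%:E * N r f)%E.
Proof.
move=> r0 mf mg M0 gM.
have mf' := cmeas_normc mf.
rewrite /Lp_norm -LnormZl//; apply: le_Lnorm => //.
- exact: cmeas_normc (cmeasM mg mf).
- exact: measurable_funM.
apply: filterS gM => x gMx; rewrite /= -!/(normc _) ComplexField.Normc.normcM.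
by rewrite !ger0_norm ?mulr_ge0 ?normc_ge0// ler_wpM2r ?normc_ge0.
Qed.

Lemma Lp_hoelder (p q : R) f g : 0 < p -> 0 < q -> p^-1 + q^-1 = 1 ->
  cmeas f -> cmeas g -> (N 1 (f \* g)%R <= N p f * N q g)%E.
Proof.
move=> p0 q0 pq mf mg.
have mf' := cmeas_normc mf; have mg' := cmeas_normc mg.
apply: le_trans (hoelder arc mf' mg' p0 q0 pq).
apply: le_Lnorm => //; first exact: cmeas_normc (cmeasM mf mg).
  exact: measurable_funM.
by apply: aeW => x /=; rewrite -!/(normc _) ComplexField.Normc.normcM.
Qed.

Lemma arcT : arc [set: R] = 1%E.
Proof. exact: probability_setT. Qed.

Lemma Lp_norm_cone r : N r (@cone R) = 1%E.
Proof.
rewrite /Lp_norm (_ : (fun _ => _) = cst 1%E).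
  by rewrite Lnorm_cst1 (_ : _ [set: _] = 1%E) ?poweR_EFin ?powR1//; exact: arcT.
by apply/funext => x /=; rewrite expr1n expr0n addr0 sqrtr1.
Qed.

(** Arc length has total mass one, so this is Hoelder's inequality against the
    constant function one. *)
Lemma Lp_norm1_le r f : 1 <= r -> cmeas f -> (N 1 f <= N r f)%E.
Proof.
rewrite le_eqVlt => /predU1P[<-//|r1] mf.
have r0 : 0 < r by exact: lt_trans r1.
have s0 : 0 < (1 - r^-1)^-1 by rewrite invr_gt0 subr_gt0 invf_lt1.
have := @Lp_hoelder r (1 - r^-1)^-1 f (@cone R) r0 s0 _ mf (cmeas_cst 1).
rewrite invrK addrC subrK => /(_ erefl).
rewrite Lp_norm_cone mule1; apply: le_trans; rewrite (_ : f \* cone = f)//.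
by apply/funext => t /=; rewrite mulr1.
Qed.

Lemma Lp_norm_eq0 r f : 0 < r -> cmeas f -> N r f = 0%E -> ae_circle f czero.
Proof.
move=> r0 mf /Lnorm_eq0_eq0 h.
have := h _ _; rewrite lte_fin => /(_ _ r0) h'.
have {h'} := h' (proj2 (measurable_EFinP _ _) (cmeas_normc mf)).
apply: filterS => x /(_ I)/= [] /eqP; rewrite -/(normc _) normc_eq0 => /eqP.
by [].
Qed.

End circle_norms.

Section Lp_closure.
Context {R : realType}.
Implicit Types (f g : cfun R) (r : R).
Notation N r f := (Lp_norm r%:E f).

Lemma LooP g : Lp +oo%E g <->
  cmeas g /\ exists2 M : R, 0 <= M & {ae arc, forall x, normc (g (cis x)) <= M}.
Proof.
have arc1 : (0 < arc [set: R])%E by rewrite arcT lte01.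
split => [[m1 m2]|[[m1 m2] [M M0 gM]]].
  rewrite /Lp_norm unlock arc1 => gfin; split; first by split.
  have [M gM] : exists M : R, (ess_sup arc (abse \o (fun x => (normc (g (cis x)))%:E)) <= M%:E)%E.
    move: gfin; case: (ess_sup _ _) => [M _|//|_].
      by exists M.
    by exists 0; rewrite leNye.
  exists `|M| => //; have /ess_supP := gM.
  apply: filterS => x /=; rewrite lee_fin normr_normc => /le_trans; apply.
  exact: ler_norm.
split => //; rewrite /Lp_norm unlock arc1.
apply: le_lt_trans (ltry M); apply/ess_supP; apply: filterS gM => x /= gx.
by rewrite lee_fin normr_normc.
Qed.

Lemma LooM f g : Lp +oo%E f -> Lp +oo%E g -> Lp +oo%E (f \* g).
Proof.
move=> /LooP[mf [M M0 fM]] /LooP[mg [K K0 gK]]; apply/LooP; split.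
  exact: cmeasM.
exists (M * K); first exact: mulr_ge0.
apply: filterS2 fM gK => x fx gx /=.
by rewrite -/(normc _) ComplexField.Normc.normcM ler_pM// normc_ge0.
Qed.

Lemma LooD f g : Lp +oo%E f -> Lp +oo%E g -> Lp +oo%E (f \+ g).
Proof.
move=> /LooP[mf [M M0 fM]] /LooP[mg [K K0 gK]]; apply/LooP; split.
  exact: cmeasD.
exists (M + K); first exact: addr_ge0.
apply: filterS2 fM gK => x fx gx /=.
by apply: le_trans (le_normcD _ _) _; exact: lerD.
Qed.

Lemma Loo_cst (z : R[i]) : Lp +oo%E (fun _ : R[i] => z).
Proof.
apply/LooP; split; first exact: cmeas_cst.
by exists (normc z); [exact: normc_ge0|exact: aeW].
Qed.

Lemma Loo_cpow (n : int) : Lp +oo%E (@cpow R n).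
Proof.
apply/LooP; split; first exact: cmeas_cpow.
exists 1 => //; apply: aeW => x; rewrite /cpow cis_exp.
by rewrite normc_cis.
Qed.

Lemma Loo_sum (I : Type) (s : seq I) (F : I -> cfun R) :
  (forall i, Lp +oo%E (F i)) -> Lp +oo%E (fun t => \sum_(i <- s) F i t).
Proof.
move=> mF; elim: s => [|i s IH].
  by under eq_fun do rewrite big_nil; exact: Loo_cst.
under eq_fun do rewrite big_cons.
exact: LooD.
Qed.

Lemma Loo_horner (s : {poly R[i]}) : Lp +oo%E (horner s).
Proof.
rewrite (_ : horner s = fun t => \sum_(i < size s) (s`_i * cpow i%:Z t)).
  by apply: Loo_sum => i; apply: (@LooM (fun _ : R[i] => s`_i)); [exact: Loo_cst|exact: Loo_cpow].
by apply/funext => t; rewrite horner_coef.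
Qed.

Lemma LpD r f g : 1 <= r -> Lp r%:E f -> Lp r%:E g -> Lp r%:E (f \+ g).
Proof.
move=> r1 [f1 f2 f3] [g1 g2 g3].
have [? ?] : cmeas (f \+ g) by exact: cmeasD.
split => //; apply: le_lt_trans (Lp_normD r1 (conj f1 f2) (conj g1 g2)) _.
exact: lte_add_pinfty.
Qed.

Lemma LpM r f g : 0 < r -> Lp +oo%E g -> Lp r%:E f -> Lp r%:E (g \* f).
Proof.
move=> r0 /LooP[mg [M M0 gM]] [f1 f2 f3].
have [? ?] : cmeas (g \* f) by exact: cmeasM.
split => //; apply: le_lt_trans (Lp_normM r0 (conj f1 f2) mg M0 gM) _.
by rewrite lte_mul_pinfty.
Qed.

Lemma LpZ r f (z : R[i]) : 0 < r -> Lp r%:E f -> Lp r%:E (cscale z f).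
Proof. by move=> r0; apply: LpM r0 _; exact: Loo_cst. Qed.

Lemma LpB r f g : 1 <= r -> Lp r%:E f -> Lp r%:E g -> Lp r%:E (f \- g).
Proof.
move=> r1 lf lg; rewrite (_ : f \- g = f \+ cscale (-1) g).
  by apply: LpD => //; apply: LpZ => //; exact: lt_le_trans r1.
by apply/funext => t; rewrite /cscale /= mulN1r.
Qed.

Lemma Lp_mulC (r : \bar R) f g : Lp r (f \* g) -> Lp r (g \* f).
Proof. by rewrite (_ : f \* g = g \* f)//; apply/funext => t /=; rewrite mulrC. Qed.

Lemma Lp_prod (p q : R) f g : 0 < p -> 0 < q -> p^-1 + q^-1 = 1 ->
  Lp p%:E f -> Lp q%:E g -> Lp 1 (f \* g).
Proof.
move=> p0 q0 pq [f1 f2 f3] [g1 g2 g3].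
have [? ?] : cmeas (f \* g) by exact: cmeasM.
split => //; apply: le_lt_trans (Lp_hoelder p0 q0 pq (conj f1 f2) (conj g1 g2)) _.
rewrite lte_mul_pinfty// ?Lp_norm_ge0//.
by rewrite ge0_fin_numE ?Lp_norm_ge0.
Qed.

Lemma Lp_L1 r f : 1 <= r -> Lp r%:E f -> Lp 1 f.
Proof.
move=> r1 [f1 f2 f3]; split => //.
exact: le_lt_trans (Lp_norm1_le r1 (conj f1 f2)) _.
Qed.

Lemma Loo_Lp r f : 0 < r -> Lp +oo%E f -> Lp r%:E f.
Proof.
move=> r0 lf.
have l1 : Lp r%:E (@cone R).
  have [? ?] : cmeas (@cone R) by exact: cmeas_cst.
  by split => //; rewrite Lp_norm_cone ltry.
have := LpM r0 lf l1.
by rewrite (_ : f \* cone = f)//; apply/funext => t /=; rewrite mulr1.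
Qed.

Lemma L1_sum (I : Type) (s : seq I) (F : I -> cfun R) :
  (forall i, Lp 1 (F i)) -> Lp 1 (fun t => \sum_(i <- s) F i t).
Proof.
move=> lF; elim: s => [|i s IH].
  by under eq_fun do rewrite big_nil; exact: Loo_Lp (Loo_cst _).
by under eq_fun do rewrite big_cons; exact: LpD.
Qed.

End Lp_closure.

(** * The mean value *)

Section cmean_theory.
Context {R : realType}.
Implicit Types (f g : cfun R) (r : R).
Notation N r f := (Lp_norm r%:E f).

Lemma integral_le_Lp_norm1 f (w : R -> R) : cmeas f -> measurable_fun setT w ->
  (forall x, `|w x| <= normc (f (cis x))) ->
  (\int[arc]_x `|(w x)%:E| <= N 1 f)%E.
Proof.
move=> mf mw wf; rewrite /Lp_norm Lnorm1; apply: ge0_le_integral => //.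
- by do 2 apply: measurableT_comp => //.
- by do 2 apply: measurableT_comp => //; exact: cmeas_normc.
- by move=> x _; rewrite /= lee_fin normr_normc wf.
Qed.

Lemma L1_integrable_Re f : Lp 1 f ->
  arc.-integrable setT (EFin \o (fun x => complex.Re (f (cis x)))).
Proof.
move=> [f1 f2 f3]; apply/integrableP; split; first exact/measurable_EFinP.
apply: le_lt_trans f3; apply: integral_le_Lp_norm1 => // x; exact: normc_Re.
Qed.

Lemma L1_integrable_Im f : Lp 1 f ->
  arc.-integrable setT (EFin \o (fun x => complex.Im (f (cis x)))).
Proof.
move=> [f1 f2 f3]; apply/integrableP; split; first exact/measurable_EFinP.
apply: le_lt_trans f3; apply: integral_le_Lp_norm1 => // x; exact: normc_Im.
Qed.

Lemma cmean_ae f g : cmeas f -> cmeas g -> ae_circle f g -> cmean f = cmean g.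
Proof.
move=> [f1 f2] [g1 g2] fg; rewrite /cmean /Rintegral; congr (fine _ +i* fine _).
  apply: ae_eq_integral => //; try exact/measurable_EFinP.
  by apply: filterS fg => x ->.
apply: ae_eq_integral => //; try exact/measurable_EFinP.
by apply: filterS fg => x ->.
Qed.

Lemma cmean_eq f g : (forall x, f (cis x) = g (cis x)) -> cmean f = cmean g.
Proof.
by move=> fg; rewrite /cmean; congr (_ +i* _); apply: eq_Rintegral => x _; rewrite fg.
Qed.

Lemma cmeanD f g : Lp 1 f -> Lp 1 g -> cmean (f \+ g) = cmean f + cmean g.
Proof.
move=> lf lg; rewrite /cmean.
have -> : \int[arc]_x complex.Re ((f \+ g) (cis x)) =
  \int[arc]_x (complex.Re (f (cis x)) + complex.Re (g (cis x))).
  by apply: eq_Rintegral => x _; rewrite /= raddfD.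
have -> : \int[arc]_x complex.Im ((f \+ g) (cis x)) =
  \int[arc]_x (complex.Im (f (cis x)) + complex.Im (g (cis x))).
  by apply: eq_Rintegral => x _; rewrite /= raddfD.
rewrite !RintegralD//; try exact: L1_integrable_Re; exact: L1_integrable_Im.
Qed.

Lemma cmeanZ f (z : R[i]) : Lp 1 f -> cmean (cscale z f) = z * cmean f.
Proof.
case: z => a b lf; rewrite /cmean.
have iR := L1_integrable_Re lf; have iI := L1_integrable_Im lf.
have iZ (c : R) (u : R -> R) : arc.-integrable setT (EFin \o u) ->
  arc.-integrable setT (EFin \o (fun x => c * u x)).
  by move=> iu; exact: (integrableZl _ c iu).
have -> : \int[arc]_x complex.Re (cscale (a +i* b) f (cis x)) =
  \int[arc]_x (a * complex.Re (f (cis x)) - b * complex.Im (f (cis x))).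
  by apply: eq_Rintegral => x _; rewrite /cscale /=; case: (f _).
have -> : \int[arc]_x complex.Im (cscale (a +i* b) f (cis x)) =
  \int[arc]_x (a * complex.Im (f (cis x)) + b * complex.Re (f (cis x))).
  by apply: eq_Rintegral => x _; rewrite /cscale /=; case: (f _).
rewrite RintegralB ?RintegralD//; try exact: iZ.
by rewrite !RintegralZl.
Qed.

Lemma cmeanB f g : Lp 1 f -> Lp 1 g -> cmean (f \- g) = cmean f - cmean g.
Proof.
move=> lf lg; rewrite (_ : f \- g = f \+ cscale (-1) g).
  by rewrite cmeanD// ?cmeanZ// ?mulN1r//; exact: LpZ.
by apply/funext => t; rewrite /cscale /= mulN1r.
Qed.

(** The factor two comes from estimating the two real components separately; any
    constant would serve, since the bound is only used to pass to limits. *)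
Lemma normc_cmean_le f : Lp 1 f -> ((normc (cmean f))%:E <= 2%:E * N 1 f)%E.
Proof.
move=> lf; have iR := L1_integrable_Re lf; have iI := L1_integrable_Im lf.
have mf := Lp_meas lf; case: (mf) => f1 f2.
apply: (@le_trans _ _ (`|\int[arc]_x complex.Re (f (cis x))|%:E + `|\int[arc]_x complex.Im
  (f (cis x))|%:E)%E).
  by rewrite -EFinD lee_fin; apply: normc_le_Re_Im.
have -> : (2%:E = 1%E + 1%E :> \bar R)%E by rewrite -EFinD.
rewrite ge0_muleDl// !mul1e.
apply: leeD; rewrite EFin_normr_Rintegral//.
- apply: (le_trans (le_abse_integral _ _ _)) => //; first exact/measurable_EFinP.
  by apply: integral_le_Lp_norm1 => // x; exact: normc_Re.
- apply: (le_trans (le_abse_integral _ _ _)) => //; first exact/measurable_EFinP.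
  by apply: integral_le_Lp_norm1 => // x; exact: normc_Im.
Qed.

Lemma cmean_sum (I : Type) (s : seq I) (F : I -> cfun R) :
  (forall i, Lp 1 (F i)) -> cmean (fun t => \sum_(i <- s) F i t) = \sum_(i <- s) cmean (F i).
Proof.
move=> lF; elim: s => [|i s IH].
  under eq_fun do rewrite big_nil.
  by rewrite big_nil /cmean /= !Rintegral_cst//= !mul0r.
rewrite big_cons -IH -cmeanD//; last exact: L1_sum.
by apply: cmean_eq => x; rewrite big_cons.
Qed.

End cmean_theory.

(** * Reflection of the circle *)

Section reflection.
Context {R : realType}.
Implicit Types (f g : cfun R) (r : R).

(** The substitution t |-> 1/t in the angle coordinate. It is x |-> 2 pi - x and
    not x |-> - x, because [arc] lives on the interval from 0 to 2 pi. *)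
Definition refl_angle (x : measurableTypeR R) : measurableTypeR R := 2 * pi - x.

Lemma refl_angle_measurable : measurable_fun setT refl_angle.
Proof. by apply: measurable_funB => //; exact: measurable_cst. Qed.

HB.instance Definition _ := isMeasurableFun.Build _ _ _ _ refl_angle refl_angle_measurable.

Lemma lebesgue_refl_angle (A : set (measurableTypeR R)) : measurable A ->
  pushforward lebesgue_measure refl_angle A = lebesgue_measure A.
Proof.
move=> mA; apply/esym/lebesgue_measure_unique => //= _ [[a b]] _ <-.
rewrite /pushforward (_ : refl_angle @^-1` _ = `[2 * pi - b, 2 * pi - a[%classic).
  by rewrite !lebesgue_measure_itv/= !lte_fin ltrD2l ltrN2 -!EFinB (_ : 2 * pi - a - (2 *
    pi - b) = b - a) //; ring.
apply/seteqP; split => x; rewrite /refl_angle /= !in_itv/=; lra.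
Qed.

Lemma arc_refl_angle (A : set (measurableTypeR R)) : measurable A ->
  pushforward arc refl_angle A = arc A.
Proof.
move=> mA; rewrite /pushforward /arc /uniform_prob.
set pdf := uniform_pdf _ _.
have pdfE x : pdf x = pdf (refl_angle x).
  by rewrite /pdf /uniform_pdf /refl_angle; congr (if _ then _ else _); apply/idP/idP; lra.
under eq_integral do rewrite pdfE.
rewrite -(@ge0_integral_pushforward _ _ _ _ _ _ refl_angle_measurable lebesgue_measure A
  (EFin \o pdf))//.
- by apply: eq_measure_integral => B mB _; exact: lebesgue_refl_angle.
- by apply/measurable_EFinP; apply: measurable_funTS; exact: measurable_uniform_pdf.
- by move=> y _; rewrite lee_fin; apply: uniform_pdf_ge0; exact: two_pi_gt0.
Qed.

End reflection.

Section tilde_flip.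
Context {R : realType}.
Implicit Types (f g : cfun R) (r : R).
Notation N r f := (Lp_norm r%:E f).

Lemma cis_refl_angle (x : R) : cis (refl_angle x) = (cis x)^-1.
Proof. by rewrite /refl_angle cis_2piB cisN. Qed.

Lemma ae_refl_angle (Q : R -> Prop) : {ae arc, forall x, Q x} ->
  {ae arc, forall x, Q (refl_angle x)}.
Proof.
move=> [A [mA A0 QA]]; exists (refl_angle @^-1` A); split.
- by rewrite -[X in measurable X]setTI; exact: refl_angle_measurable.
- by have := arc_refl_angle mA; rewrite A0.
- by move=> x /= h; apply: QA.
Qed.

Lemma ae_tilde f g : ae_circle f g -> ae_circle (tilde f) (tilde g).
Proof.
move=> /(@ae_refl_angle (fun x => f (cis x) = g (cis x))).
by apply: filterS => x; rewrite cis_refl_angle.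
Qed.

Lemma ae_flip f g : ae_circle f g -> ae_circle (flip f) (flip g).
Proof. by move=> /ae_tilde; apply: filterS => x; rewrite /flip /tilde => ->. Qed.

Lemma Loo_tilde f : Lp +oo%E f -> Lp +oo%E (tilde f).
Proof.
move=> /LooP[mf [M M0 fM]]; apply/LooP; split; first exact: cmeas_tilde.
exists M => //.
by apply: filterS (@ae_refl_angle (fun x => normc (f (cis x)) <= M) fM) => x;
  rewrite cis_refl_angle.
Qed.

Lemma integral_refl_angle (G : R -> \bar R) : measurable_fun setT G -> (forall x, 0 <= G x)%E ->
  (\int[arc]_x G (refl_angle x) = \int[arc]_x G x)%E.
Proof.
move=> mG G0.
have := @ge0_integral_pushforward _ _ _ _ _ _ refl_angle_measurable arc setT G measurableT
  mG (fun x _ => G0 x).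
rewrite preimage_setT => <-.
by apply: eq_measure_integral => B mB _; exact: arc_refl_angle.
Qed.

Lemma Rintegral_refl_angle (G : R -> R) : arc.-integrable setT (EFin \o G) ->
  \int[arc]_x G (refl_angle x) = \int[arc]_x G x.
Proof.
move=> iG; rewrite /Rintegral; congr fine.
have /integrableP[/measurable_EFinP mG _] := iG.
rewrite -[RHS]/(\int[arc]_x (EFin \o G) x)%E -[LHS]/(\int[arc]_x ((EFin \o G) (refl_angle x)))%E.
rewrite integralE [RHS]integralE; congr (_ - _)%E.
- rewrite -(integral_refl_angle (G := (EFin \o G)^\+)%E)//;
    first by apply: eq_integral => x _; rewrite ?funeposE ?funenegE.
  by apply: measurable_funepos; exact/measurable_EFinP.
- rewrite -(integral_refl_angle (G := (EFin \o G)^\-)%E)//;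
    first by apply: eq_integral => x _; rewrite ?funeposE ?funenegE.
  by apply: measurable_funeneg; exact/measurable_EFinP.
Qed.

Lemma Lp_norm_tilde r f : cmeas f -> N r (tilde f) = N r f.
Proof.
move=> mf.
rewrite -[LHS]/('N[arc]_r%:E[EFin \o (fun x => normc (tilde f (cis x)))])%E LnormE.
rewrite -[RHS]/('N[arc]_r%:E[EFin \o (fun x => normc (f (cis x)))])%E LnormE.
apply: (congr1 (fun z => z `^ r^-1)%E).
rewrite -(integral_refl_angle (G := fun x => (`|normc (f (cis x))| `^ r)%:E)).
- by apply: eq_integral => x _; rewrite cis_refl_angle.
- by apply/measurable_EFinP; apply: measurable_normr_powR; exact: cmeas_normc.
- by move=> x; rewrite lee_fin powR_ge0.
Qed.

Lemma Lp_tilde r f : Lp r%:E f -> Lp r%:E (tilde f).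
Proof.
move=> lf; have mf := Lp_meas lf; have [? ?] := cmeas_tilde mf.
by split => //; rewrite Lp_norm_tilde//; case: lf.
Qed.

Lemma cmean_tilde f : Lp 1 f -> cmean (tilde f) = cmean f.
Proof.
move=> lf; rewrite /cmean; congr (_ +i* _).
- rewrite -[RHS]Rintegral_refl_angle; last exact: L1_integrable_Re.
  by apply: eq_Rintegral => x _; rewrite cis_refl_angle.
- rewrite -[RHS]Rintegral_refl_angle; last exact: L1_integrable_Im.
  by apply: eq_Rintegral => x _; rewrite cis_refl_angle.
Qed.

Lemma flipE f : flip f = cpow (-1) \* tilde f.
Proof. by apply/funext => t; rewrite /flip /cpow /tilde /= exprN1. Qed.

Lemma flipKE f (x : R) : flip (flip f) (cis x) = f (cis x).
Proof. by rewrite /flip invrK mulrA mulVf ?mul1r// cis_neq0. Qed.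

Lemma Lp_flip r f : 0 < r -> Lp r%:E f -> Lp r%:E (flip f).
Proof. by move=> r0 lf; rewrite flipE; apply: LpM => //; [exact: Loo_cpow|exact: Lp_tilde]. Qed.

End tilde_flip.

(** * Fourier coefficients *)

Section fourier_theory.
Context {R : realType}.
Implicit Types (f g : cfun R) (r : R) (n k : int).
Notation N r f := (Lp_norm r%:E f).

Lemma L1_cpow f n : Lp 1 f -> Lp 1 (f \* cpow n).
Proof. by move=> lf; apply: Lp_mulC; apply: LpM lf => //; exact: Loo_cpow. Qed.

Lemma fourierE f n : fourier f n = cmean (f \* cpow (- n)).
Proof. by []. Qed.

Lemma fourier_ae f g n : cmeas f -> cmeas g -> ae_circle f g -> fourier f n = fourier g n.
Proof.
move=> mf mg fg; apply: cmean_ae.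
- exact: (cmeasM mf (cmeas_cpow _)).
- exact: (cmeasM mg (cmeas_cpow _)).
- by apply: filterS fg => x ->.
Qed.

Lemma fourier_eq f g n : (forall x, f (cis x) = g (cis x)) -> fourier f n = fourier g n.
Proof. by move=> fg; apply: cmean_eq => x; rewrite fg. Qed.

Lemma fourierD f g n : Lp 1 f -> Lp 1 g -> fourier (f \+ g) n = fourier f n + fourier g n.
Proof.
move=> lf lg; rewrite !fourierE -cmeanD; [|exact: L1_cpow..].
by apply: cmean_eq => x /=; rewrite mulrDl.
Qed.

Lemma fourierB f g n : Lp 1 f -> Lp 1 g -> fourier (f \- g) n = fourier f n - fourier g n.
Proof.
move=> lf lg; rewrite !fourierE -cmeanB; [|exact: L1_cpow..].
by apply: cmean_eq => x /=; rewrite mulrBl.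
Qed.

Lemma fourierZ f (z : R[i]) n : Lp 1 f -> fourier (cscale z f) n = z * fourier f n.
Proof.
move=> lf; rewrite !fourierE -cmeanZ; last exact: L1_cpow.
by apply: cmean_eq => x /=; rewrite /cscale mulrA.
Qed.

Lemma fourier_shift f k n : fourier (cpow k \* f) n = fourier f (n - k).
Proof.
apply: cmean_eq => x; rewrite /cpow /= mulrAC -expfzDr ?cis_neq0// mulrC.
by congr (_ * _ ^ _); lia.
Qed.

Lemma fourier_tilde f n : Lp 1 f -> fourier (tilde f) n = fourier f (- n).
Proof.
move=> lf; rewrite fourierE -cmean_tilde; last first.
  by apply: L1_cpow; exact: Lp_tilde.
by apply: cmean_eq => x; rewrite /tilde /cpow /= invrK exprz_inv opprK.
Qed.

Lemma fourier_flip f n : Lp 1 f -> fourier (flip f) n = fourier f (- n - 1).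
Proof.
move=> lf; rewrite flipE fourier_shift fourier_tilde//; congr fourier; lia.
Qed.

Lemma fourier_sum (I : Type) (s : seq I) (F : I -> cfun R) n :
  (forall i, Lp 1 (F i)) ->
  fourier (fun t => \sum_(i <- s) F i t) n = \sum_(i <- s) fourier (F i) n.
Proof.
move=> lF; rewrite /fourier -(@cmean_sum _ _ s (fun i => F i \* cpow (- n))).
  by apply: cmean_eq => x; rewrite mulr_suml.
by move=> i; exact: L1_cpow.
Qed.

Lemma normc_fourier_le f n : Lp 1 f -> ((normc (fourier f n))%:E <= 2%:E * N 1 f)%E.
Proof.
move=> lf; have mf := Lp_meas lf.
apply: le_trans (normc_cmean_le (L1_cpow (- n) lf)) _.
rewrite lee_pmul2l//.
apply: Lp_norm_le => //; first exact: cmeasM mf (cmeas_cpow _).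
apply: aeW => x /=; rewrite -!/(normc _) ComplexField.Normc.normcM.
by rewrite /cpow cis_exp normc_cis mulr1.
Qed.

(* The integral against [arc] reduces to a Lebesgue integral for nonnegative
   integrands only, whence the summand 1 in the primitive F. *)
Lemma integral_cos_nat (n : nat) : (0 < n)%N -> \int[arc]_x cos (n%:R * x : R) = 0.
Proof.
move=> n0; have nR : (n%:R : R) != 0 by rewrite pnatr_eq0 -lt0n.
pose F : R -> R := fun x => x + n%:R^-1 * sin (n%:R * x).
have dF (x : R) : is_derive x 1 F (1 + cos (n%:R * x)).
  rewrite /F; apply: is_derive_eq.
  by rewrite /GRing.scale /=; field.
have cn : continuous (fun x : R => 1 + cos (n%:R * x) : R).
  move=> x; apply: continuousD; first exact: cst_continuous.
  apply: (@continuous_comp _ _ _ (fun x : R => n%:R * x) (@cos R)); last exact: continuous_cos.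
  exact: mulrl_continuous.
have cF : continuous F.
  by move=> x; apply: differentiable_continuous; apply/derivable1_diffP; case: (dF x).
have mc : measurable_fun setT (fun x : R => 1 + cos (n%:R * x) : R).
  exact: measurable_realfun.continuous_measurable_fun.
have H : (\int[arc]_x (1 + cos (n%:R * (x : R)))%:E = 1)%E.
  rewrite integral_uniform; last 2 first.
  - exact/measurable_EFinP.
  - by move=> x; rewrite lee_fin -lerBlDl sub0r; exact: cos_geN1.
  rewrite (@continuous_FTC2 R _ F).
  - rewrite /F subr0 -EFinB mulr0 sin0 mulr0 addr0 subr0.
    rewrite (_ : n%:R * (2 * pi) = 0 + pi *+ 2 *+ n);
      last by rewrite add0r -[RHS]mulr_natl -(mulr_natl pi).
    rewrite (periodicn (@sinD2pi R)) sin0 mulr0 addr0 -EFinM mulVf// gt_eqF//.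
    exact: two_pi_gt0.
  - exact: two_pi_gt0.
  - exact: continuous_subspaceT.
  - split => [x _||].
    + by case: (dF x).
    + by apply: cvg_at_right_filter; exact: cF.
    + by apply: cvg_at_left_filter; exact: cF.
  - by move=> x _; rewrite derive1E; exact: (@derive_val _ _ _ _ _ _ _ (dF x)).
have ic := L1_integrable_Re (Loo_Lp ltr01 (@Loo_cpow R n%:Z)).
have ic' : arc.-integrable setT (EFin \o (fun x : R => cos (n%:R * x))).
  by move: ic; under [X in _.-integrable _ (_ \o X)]eq_fun do rewrite /cpow cis_exp.
have {H} : \int[arc]_x (1 + cos (n%:R * (x : R))) = 1 by rewrite /Rintegral H.
rewrite RintegralD//; last first.
  exact: (L1_integrable_Re (Loo_Lp ltr01 (@Loo_cst R 1))).
rewrite Rintegral_cst//= mul1r (_ : _ [set: _] = 1%E); last exact: arcT.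
have h (z : R) : 1 + z = 1 -> z = 0 by lra.
exact: h.
Qed.

Lemma integral_sin (n : int) : \int[arc]_x sin (n%:~R * x : R) = 0.
Proof.
have h0 (z : R) : - z = z -> z = 0 by lra.
have iS : arc.-integrable setT (EFin \o (fun x : R => sin (n%:~R * x))).
  have := L1_integrable_Im (Loo_Lp ltr01 (@Loo_cpow R n)).
  by under [X in _.-integrable _ (_ \o X)]eq_fun do rewrite /cpow cis_exp.
have := Rintegral_refl_angle iS.
under eq_Rintegral.
  move=> x _; rewrite (_ : sin _ = - sin (n%:~R * x)); last first.
    have := cis_refl_angle x => /(congr1 (fun z => z ^ n)).
    by rewrite exprz_inv -[X in X ^ (- _)]/(cis x) !cis_exp => /(congr1 (@complex.Im R))/=;
      rewrite intrN mulNr sinN.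
  over.
rewrite (_ : \int[arc]_x (- sin (n%:~R * x)) = - \int[arc]_x (sin (n%:~R * x))); first exact: h0.
rewrite -mulN1r -RintegralZl//.
by apply: eq_Rintegral => x _; rewrite mulN1r.
Qed.

Lemma fourier_cpow k n : fourier (@cpow R k) n = (k == n)%:R.
Proof.
rewrite /fourier.
have -> : cmean (fun t : R[i] => cpow k t * t ^ (- n)) = cmean (@cpow R (k - n)).
  by apply: cmean_eq => x; rewrite /cpow -expfzDr// cis_neq0.
rewrite -subr_eq0; move: (k - n) => m {k n}.
rewrite /cmean; under eq_Rintegral do rewrite /cpow cis_exp /=.
under [X in _ +i* X]eq_Rintegral do rewrite /cpow cis_exp /=.
rewrite integral_sin.
have [->|m0] := eqVneq m 0.
  under eq_Rintegral do rewrite mul0r cos0.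
  rewrite Rintegral_cst//= mul1r.
  by rewrite (_ : _ [set: _] = 1%E)//; exact: arcT.
have -> : \int[arc]_x cos (m%:~R * (x : R)) = 0; last by [].
rewrite -[RHS](@integral_cos_nat `|m|%N) ?absz_gt0//.
apply: eq_Rintegral => x _; case: m {m0} => m //=.
by rewrite NegzE intrN mulNr cosN.
Qed.

End fourier_theory.

(** * Fejer's kernel *)

Section fejer_kernel.
Context {R : realType}.
Implicit Types (x y u r : R) (h g : R -> R).

(** Fejer's kernel at the angle y - x; its argument n gives the kernel of order
    n + 1, so that the normalization never divides by zero. *)
Definition fejer_kernel (n : nat) y x : R :=
  n.+1%:R^-1 * \sum_(j < n.+1) \sum_(k < n.+1) cos ((j%:Z - k%:Z)%:~R * (y - x)).

Lemma fejer_kernel_normc n y x : fejer_kernel n y x =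
  n.+1%:R^-1 * normc (\sum_(j < n.+1) cis (y - x) ^+ j) ^+ 2.
Proof.
rewrite /fejer_kernel; congr (_ * _); move: (y - x) => u.
have -> : \sum_(j < n.+1) cis u ^+ j =
    (\sum_(j < n.+1) cos (j%:R * u)) +i* (\sum_(j < n.+1) sin (j%:R * u)).
  under eq_bigr do rewrite cis_nat.
  apply/eqP; rewrite eq_complex /=.
  by rewrite !raddf_sum /= !eqxx.
rewrite /= sqr_sqrtr ?addr_ge0 ?sqr_ge0// !expr2 !big_distrlr /= -big_split.
apply: eq_bigr => j _; rewrite -big_split; apply: eq_bigr => k _ /=.
by rewrite -cosB intrB mulrBl.
Qed.

Lemma fejer_kernel_ge0 n y x : 0 <= fejer_kernel n y x.
Proof. by rewrite fejer_kernel_normc mulr_ge0 ?invr_ge0// sqr_ge0. Qed.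

Lemma fejer_kernel_le n y x : fejer_kernel n y x <= n.+1%:R.
Proof.
rewrite /fejer_kernel mulrC ler_pdivrMr//.
apply: (@le_trans _ _ (\sum_(j < n.+1) \sum_(k < n.+1) 1)).
  by do 2 apply: ler_sum => ? _; exact: cos_le1.
by rewrite !sumr_const !card_ord mulr_natr.
Qed.

(** The kernel is the square of a geometric sum, which the chord makes telescope.
    This bound is all that is used of the concentration of the kernel. *)
Lemma fejer_kernel_chord n y x :
  fejer_kernel n y x * normc (cis y - cis x) ^+ 2 <= 4 / n.+1%:R.
Proof.
rewrite fejer_kernel_normc mulrC [leRHS]mulrC mulrCA ler_pM2l ?invr_gt0//.
rewrite -exprMn -ComplexField.Normc.normcM.
have -> : cis y - cis x = cis x * (cis (y - x) - 1).
  by rewrite mulrBr mulr1 -cisD subrKC.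
rewrite -mulrA -subrX1 ComplexField.Normc.normcM normc_cis mul1r cis_nat.
have : normc (cis (n.+1%:R * (y - x)) - 1) <= 2.
  apply: le_trans (le_normcD _ _) _.
  by rewrite normc_cis normcN ComplexField.Normc.normc1.
have := normc_ge0 (cis (n.+1%:R * (y - x)) - 1); nra.
Qed.

Lemma fejer_kernelC n y x : fejer_kernel n y x = fejer_kernel n x y.
Proof.
rewrite /fejer_kernel; congr (_ * _).
by do 2 apply: eq_bigr => ? _; rewrite -cosN -mulrN opprB.
Qed.

Lemma fejer_kernel_measurable2 n :
  measurable_fun setT (fun z : measurableTypeR R * measurableTypeR R => fejer_kernel n z.1 z.2).
Proof.
apply: measurable_funM; first exact: measurable_cst.
apply: measurable_sum => j; apply: measurable_sum => k.
apply: (measurableT_comp cos_measurable); apply: measurable_funM; first exact: measurable_cst.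
by apply: measurable_funB; [exact: measurable_fst|exact: measurable_snd].
Qed.

Lemma fejer_kernel_measurable n y : measurable_fun setT (fejer_kernel n y).
Proof.
apply: measurable_funM; first exact: measurable_cst.
apply: measurable_sum => j; apply: measurable_sum => k.
apply: (measurableT_comp cos_measurable); apply: measurable_funM; first exact: measurable_cst.
by apply: measurable_funB; [exact: measurable_cst|exact: measurable_id].
Qed.

Lemma bounded_by (u : R -> R) (M : R) : (forall x, `|u x| <= M) -> [bounded u x | x in setT].
Proof. by move=> uM; exists M; split; [exact: num_real|move=> N MN x _;
  apply: le_trans (ltW MN)]. Qed.

Lemma integrable_bounded h (M : R) : measurable_fun setT h -> (forall x, `|h x| <= M) ->
  arc.-integrable setT (EFin \o h).
Proof.
move=> mh hM; apply: measurable_bounded_integrable => //; last exact: bounded_by hM.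
by rewrite -ge0_fin_numE ?measure_ge0// (_ : _ setT = 1%E)//; exact: arcT.
Qed.

Lemma integrable_mul_kernel n y h : arc.-integrable setT (EFin \o h) ->
  arc.-integrable setT (EFin \o (fun x => fejer_kernel n y x * h x)).
Proof.
move=> ih; have := @integrableMr _ _ _ arc setT measurableT (fejer_kernel n y) (EFin \o h).
move=> /(_ (fejer_kernel_measurable n y) _ ih); apply.
apply: (@bounded_by _ n.+1%:R) => x.
by rewrite ger0_norm ?fejer_kernel_ge0// fejer_kernel_le.
Qed.

Lemma integral_cos_int (m : int) : \int[arc]_x cos (m%:~R * x : R) = (m == 0)%:R.
Proof.
have := @fourier_cpow R m 0; rewrite /fourier => /(congr1 (@complex.Re R)).
rewrite /cmean /=.
under eq_Rintegral do rewrite oppr0 expr0z mulr1 /cpow cis_exp /=.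
by move=> ->; case: (m == 0).
Qed.

Lemma Rintegral_arc_sum (I : Type) (s : seq I) (F : I -> R -> R) :
  (forall i, arc.-integrable setT (EFin \o F i)) ->
  arc.-integrable setT (EFin \o (fun x => \sum_(i <- s) F i x)) /\
  \int[arc]_x (\sum_(i <- s) F i x) = \sum_(i <- s) \int[arc]_x F i x.
Proof.
move=> iF; elim: s => [|i s [IH1 IH2]].
  under eq_Rintegral do rewrite big_nil.
  under [X in _.-integrable _ (_ \o X)]eq_fun do rewrite big_nil.
  rewrite big_nil Rintegral_cst// mul0r; split => //.
  apply: (@integrable_bounded _ 0); first exact: measurable_cst.
  by move=> x; rewrite normr0.
under eq_Rintegral do rewrite big_cons.
under [X in _.-integrable _ (_ \o X)]eq_fun do rewrite big_cons.
rewrite big_cons -IH2 RintegralD//; split => //.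
exact: (integrableD _ (iF i) IH1).
Qed.

Lemma integral_fejer_kernel n y : \int[arc]_x fejer_kernel n y x = 1.
Proof.
have iC (m : int) (a : R) : arc.-integrable setT (EFin \o (fun x : R => a * cos (m%:~R * x))).
  apply: (@integrable_bounded _ `|a|).
    apply: measurable_funM; first exact: measurable_cst.
    by apply: (measurableT_comp cos_measurable); exact: mulrl_measurable.
  by move=> x; rewrite normrM ler_piMr// ler_norml cos_geN1 cos_le1.
have iS (m : int) (a : R) : arc.-integrable setT (EFin \o (fun x : R => a * sin (m%:~R * x))).
  apply: (@integrable_bounded _ `|a|).
    apply: measurable_funM; first exact: measurable_cst.
    by apply: (measurableT_comp sin_measurable); exact: mulrl_measurable.
  by move=> x; rewrite normrM ler_piMr// ler_norml sin_geN1 sin_le1.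
have iCB (m : int) : arc.-integrable setT (EFin \o (fun x : R => cos (m%:~R * (y - x)))).
  apply: (@integrable_bounded _ 1).
    apply: (measurableT_comp cos_measurable); apply: measurable_funM; first exact: measurable_cst.
    by apply: measurable_funB; [exact: measurable_cst|exact: measurable_id].
  by move=> x; rewrite ler_norml cos_geN1 cos_le1.
have CB (m : int) : \int[arc]_x cos (m%:~R * (y - x : R)) = (m == 0)%:R.
  under eq_Rintegral do rewrite mulrBr cosB.
  rewrite RintegralD//=.
  have i1 (v : R -> R) : arc.-integrable setT (EFin \o (fun x => 1 * v x)) ->
    arc.-integrable setT (EFin \o v).
    by under eq_fun do rewrite /= mul1r.
  rewrite !RintegralZl//; last 2 first.
  - exact: (i1 _ (iS m 1)).
  - exact: (i1 _ (iC m 1)).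
  rewrite integral_cos_int integral_sin mulr0 addr0.
  by have [->|] := eqVneq m 0; rewrite ?mulr0// mul0r cos0 mulr1.
have RSk (j : 'I_n.+1) := @Rintegral_arc_sum _ (index_enum 'I_n.+1)
  (fun (k : 'I_n.+1) x => cos ((j%:Z - k%:Z)%:~R * (y - x))) (fun k => iCB _).
have [iSS SS] := @Rintegral_arc_sum _ (index_enum 'I_n.+1) (fun (j : 'I_n.+1) x =>
  \sum_(k < n.+1) cos ((j%:Z - k%:Z)%:~R * (y - x))) (fun j => (RSk j).1).
rewrite /fejer_kernel RintegralZl// SS.
under eq_bigr => j _.
  rewrite (RSk j).2 (bigD1 j)//= CB subrr eqxx big1 => [|k kj]; last first.
    by rewrite CB subr_eq0 eqz_nat eq_sym (negbTE (kj : val k != val j)).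
  rewrite addr0; over.
by rewrite sumr_const card_ord mulVf.
Qed.

End fejer_kernel.

(** * Fejer means of real functions *)

Section fejer_means.
Context {R : realType}.
Implicit Types (x y r : R) (h g u : R -> R).
Local Notation arcI h := (arc.-integrable setT (EFin \o h)).
Local Notation Nr r h := ('N[arc]_r%:E[EFin \o h])%E.

Definition fejer_mean (n : nat) h y : R := \int[arc]_x (fejer_kernel n y x * h x).

Lemma EFin_Rintegral h : arcI h -> (\int[arc]_x h x)%:E = (\int[arc]_x (h x)%:E)%E.
Proof. by move=> ih; rewrite /Rintegral fineK//; apply: integrable_fin_num. Qed.

Lemma arcI_normr h : arcI h -> arcI (fun x => `|h x|).
Proof. by move=> ih; exact: (integrable_abse ih). Qed.

Lemma arcI_meas h : arcI h -> measurable_fun setT h.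
Proof. by case/integrableP => /measurable_EFinP. Qed.

Lemma arcI_le h g : measurable_fun setT h -> (forall x, `|h x| <= g x) -> arcI g -> arcI h.
Proof.
move=> mh hg; apply: le_integrable => //; first exact/measurable_EFinP.
by move=> x _; rewrite /= lee_fin (le_trans (hg x))// ler_norm.
Qed.

Lemma fejer_mean_le n h y : arcI h ->
  `|fejer_mean n h y| <= \int[arc]_x (fejer_kernel n y x * `|h x|).
Proof.
move=> ih; apply: le_trans (le_normr_Rintegral _ (integrable_mul_kernel n y ih)) _ => //.
apply: le_Rintegral => //.
- exact: (arcI_normr (integrable_mul_kernel n y ih)).
- exact: (integrable_mul_kernel n y (arcI_normr ih)).
- by move=> x _; rewrite normrM (ger0_norm (fejer_kernel_ge0 _ _ _)).
Qed.

Lemma fejer_mean_cst n c y : fejer_mean n (fun=> c) y = c.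
Proof.
rewrite /fejer_mean; under eq_Rintegral do rewrite mulrC.
rewrite RintegralZl//; last first.
  apply: (@integrable_bounded _ _ n.+1%:R); first exact: fejer_kernel_measurable.
  by move=> x; rewrite ger0_norm ?fejer_kernel_ge0// fejer_kernel_le.
by rewrite integral_fejer_kernel mulr1.
Qed.

Lemma fejer_meanB n h g y : arcI h -> arcI g ->
  fejer_mean n (fun x => h x - g x) y = fejer_mean n h y - fejer_mean n g y.
Proof.
move=> ih ig; rewrite /fejer_mean; under eq_Rintegral do rewrite mulrBr.
by rewrite RintegralB//; exact: integrable_mul_kernel.
Qed.

Lemma fejer_kernel_integrable n y : arcI (fejer_kernel n y).
Proof.
apply: (@integrable_bounded _ _ n.+1%:R); first exact: fejer_kernel_measurable.
by move=> x; rewrite ger0_norm ?fejer_kernel_ge0// fejer_kernel_le.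
Qed.

(** Jensen's inequality for the probability density given by the kernel: Young's
    inequality with the mean m of |h| as second factor, integrated against the
    kernel. *)
Lemma fejer_mean_jensen n h y r : 1 <= r -> arcI h -> arcI (fun x => `|h x| `^ r) ->
  `|fejer_mean n h y| `^ r <= \int[arc]_x (fejer_kernel n y x * `|h x| `^ r).
Proof.
move=> r1 ih ihr; set I := \int[arc]_x _.
have r0 : 0 < r by exact: lt_le_trans r1.
pose m := \int[arc]_x (fejer_kernel n y x * `|h x|).
have m0 : 0 <= m by apply: Rintegral_ge0 => x _; rewrite mulr_ge0 ?fejer_kernel_ge0.
have I0 : 0 <= I.
  by apply: Rintegral_ge0 => x _; rewrite mulr_ge0 ?fejer_kernel_ge0 ?powR_ge0.
apply: (@le_trans _ _ (m `^ r)).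
  by apply: ge0_ler_powR; rewrite ?nnegrE ?(ltW r0)//; exact: fejer_mean_le.
move: r1; rewrite le_eqVlt => /predU1P[r1|r1].
  rewrite -r1 powRr1// /m /I (_ : \int[arc]_x _ = \int[arc]_x (fejer_kernel n y x * `|h x| `^ r))//.
  by apply: eq_Rintegral => x _; rewrite -r1 powRr1.
have [->|mN0] := eqVneq m 0; first by rewrite powR0 ?gt_eqF.
(* s is the exponent conjugate to r *)
pose s := r / (r - 1).
have s0 : 0 < s by rewrite /s divr_gt0// subr_gt0.
have rs : r^-1 + s^-1 = 1.
  by rewrite /s invf_div -[X in X + _]mul1r -mulrDl subrKC mulfV// gt_eqF.
have bE : (m `^ (r - 1)) `^ s = m `^ r.
  by rewrite -powRrM /s mulrCA mulfV ?mulr1// subr_eq0 gt_eqF.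
have mE : m `^ r = m `^ (r - 1) * m.
  by rewrite -[X in _ * X](powRr1 m0) -powRD ?subrK// mN0 implybT.
have iK := fejer_kernel_integrable n y.
have i1 : arcI (fun x => m `^ (r - 1) * (fejer_kernel n y x * `|h x|)).
  exact: (integrableZl _ _ (integrable_mul_kernel n y (arcI_normr ih))).
have i2 : arcI (fun x => r^-1 * (fejer_kernel n y x * `|h x| `^ r)).
  exact: (integrableZl _ _ (integrable_mul_kernel n y ihr)).
have i3 : arcI (fun x => (m `^ r / s) * fejer_kernel n y x).
  exact: (integrableZl _ _ iK).
have : \int[arc]_x (m `^ (r - 1) * (fejer_kernel n y x * `|h x|)) <=
    \int[arc]_x (r^-1 * (fejer_kernel n y x * `|h x| `^ r) + (m `^ r / s) * fejer_kernel n y x).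
  apply: le_Rintegral => //; first exact: (integrableD _ i2 i3).
  move=> x _; have := @conjugate_powR R `|h x| (m `^ (r - 1)) r s.
  rewrite normr_ge0 powR_ge0 bE => /(_ isT isT r0 s0 rs) cj.
  have := ler_wpM2l (fejer_kernel_ge0 n y x) cj.
  by rewrite mulrDr; congr (_ <= _); ring.
have ih1 := integrable_mul_kernel n y (arcI_normr ih).
have ihr1 := integrable_mul_kernel n y ihr.
rewrite RintegralD// (RintegralZl _ measurableT ih1) (RintegralZl _ measurableT ihr1).
rewrite (RintegralZl _ measurableT iK).
rewrite integral_fejer_kernel mulr1 -/m -/I -mE => hle.
have sE : s^-1 = 1 - r^-1 by rewrite -rs addrAC subrr add0r.
have rI : 0 < r^-1 by rewrite invr_gt0.
move: hle; rewrite sE -/I.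
move: (m `^ r) (I : R) (r^-1 : R) rI => A B c c0 hle.
by rewrite -(ler_pM2l c0); nra.
Qed.

Lemma fejer_mean_measurable n h : arcI h -> measurable_fun setT (fejer_mean n h).
Proof.
have pos u : (forall x, 0 <= u x) -> measurable_fun setT u ->
    measurable_fun setT (fejer_mean n u).
  move=> u0 mu; rewrite /fejer_mean /Rintegral.
  apply: (@measurableT_comp _ _ _ _ _ _ (@fine R)) => //.
  apply: (@measurable_fun_fubini_tonelli_F _ _ _ _ _ (uniform_prob (@two_pi_gt0 R))
    (fun z : measurableTypeR R * measurableTypeR R => (fejer_kernel n z.1 z.2 * u z.2)%:E)).
    apply/measurable_EFinP; apply: measurable_funM; first exact: fejer_kernel_measurable2.
    by apply: (measurableT_comp mu); exact: measurable_snd.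
  by move=> z; rewrite lee_fin mulr_ge0 ?fejer_kernel_ge0.
move=> ih; have mh := arcI_meas ih.
pose hp x := Num.max (h x) 0; pose hn x := Num.max (- h x) 0.
have mp : measurable_fun setT hp by apply: measurable_maxr => //; exact: measurable_cst.
have mn : measurable_fun setT hn.
  by apply: measurable_maxr; [exact: measurableT_comp|exact: measurable_cst].
have hE x : h x = hp x - hn x.
  by rewrite /hp /hn; case: (leP (h x) 0) => h0; case: (leP (- h x) 0) => h1; lra.
have ip : arcI hp.
  apply: arcI_le mp _ (arcI_normr ih) => x; rewrite ger0_norm ?le_max ?lexx ?orbT//.
  by rewrite /hp ge_max normr_ge0 ler_norm.
have in_ : arcI hn.
  apply: arcI_le mn _ (arcI_normr ih) => x; rewrite ger0_norm ?le_max ?lexx ?orbT//.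
  by rewrite /hn ge_max normr_ge0 -normrN ler_norm.
have -> : fejer_mean n h = fun y => fejer_mean n hp y - fejer_mean n hn y.
  apply/funext => y; rewrite -fejer_meanB//.
  by congr fejer_mean; apply/funext => x; rewrite hE.
by apply: measurable_funB; apply: pos => // x; rewrite le_max lexx orbT.
Qed.

Lemma Lnorm_integrable h r : 1 <= r -> measurable_fun setT h -> (Nr r h < +oo)%E ->
  arcI h /\ arcI (fun x => `|h x| `^ r).
Proof.
move=> r1 mh hfin; have r0 : 0 < r by exact: lt_le_trans r1.
have ir : arcI (fun x => `|h x| `^ r).
  apply: (@Lfun_integrable _ _ _ (uniform_prob (@two_pi_gt0 R)) h r r1).
  by rewrite inE; apply/andP; rewrite !inE.
split => //; apply: (@arcI_le h (fun x => 1 + `|h x| `^ r)) => //.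
  move=> x; have [h1|h1] := leP `|h x| 1; first by rewrite (le_trans h1)// lerDl powR_ge0.
  rewrite -[leLHS]powRr1//; apply: (@le_trans _ _ (`|h x| `^ r)); last by rewrite lerDr.
  by rewrite ler_powR// ltW.
apply: (@integrableD _ _ _ arc setT measurableT (EFin \o (fun=> 1)) _ _ ir).
by apply: (@integrable_bounded _ _ 1); [exact: measurable_cst|move=> x; rewrite normr1].
Qed.

(** Integrate Jensen's inequality and exchange the integrals: the kernel is
    symmetric and of mean one in either variable. *)
Lemma fejer_mean_contract n h r : 1 <= r -> measurable_fun setT h ->
  (Nr r h < +oo)%E -> (Nr r (fejer_mean n h) <= Nr r h)%E.
Proof.
move=> r1 mh hfin; have r0 : 0 < r by exact: lt_le_trans r1.
have [ih ihr] := Lnorm_integrable r1 mh hfin.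
rewrite !LnormE.
have h0 w : (0 <= \int[arc]_x (`|w x : R| `^ r)%:E)%E.
  by apply: integral_ge0 => x _; rewrite lee_fin powR_ge0.
apply: gt0_ler_poweR; rewrite ?in_itv/= ?leey ?h0 ?invr_ge0 ?(ltW r0)//.
pose G := (fun z : measurableTypeR R * measurableTypeR R => (fejer_kernel n z.1 z.2 * `|h
  z.2| `^ r)%:E).
have mG : measurable_fun setT G.
  apply/measurable_EFinP; apply: measurable_funM; first exact: fejer_kernel_measurable2.
  by apply: (measurableT_comp (measurable_normr_powR r mh)); exact: measurable_snd.
have G0 z : (0 <= G z)%E by rewrite lee_fin mulr_ge0 ?fejer_kernel_ge0 ?powR_ge0.
apply: (@le_trans _ _ (\int[arc]_y \int[arc]_x G (y, x))%E).
  apply: ge0_le_integral => //.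
  - apply/measurable_EFinP; apply: measurable_normr_powR; exact: fejer_mean_measurable.
  - exact: (@measurable_fun_fubini_tonelli_F _ _ _ _ _ (uniform_prob (@two_pi_gt0 R)) G mG G0).
  - move=> y _; rewrite /G /= -EFin_Rintegral; last exact: integrable_mul_kernel.
    by rewrite lee_fin; exact: fejer_mean_jensen.
rewrite (@fubini_tonelli _ _ _ _ _ (uniform_prob (@two_pi_gt0 R)) (uniform_prob
  (@two_pi_gt0 R)) G mG G0).
apply: ge0_le_integral => //.
- by move=> x _; apply: integral_ge0 => y _.
- exact: (@measurable_fun_fubini_tonelli_G _ _ _ _ _ (uniform_prob (@two_pi_gt0 R)) G mG G0).
- by apply/measurable_EFinP; exact: measurable_normr_powR.
- move=> x _; rewrite /G /=.
  under eq_integral do rewrite mulrC fejer_kernelC.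
  rewrite -(@EFin_Rintegral (fun y => `|h x| `^ r * fejer_kernel n x y)); last first.
    exact: (integrableZl _ _ (fejer_kernel_integrable n x)).
  rewrite RintegralZl//; last exact: fejer_kernel_integrable.
  by rewrite integral_fejer_kernel mulr1.
Qed.

End fejer_means.

(** * Convergence of Fejer means *)

Section fejer_convergence.
Context {R : realType}.
Implicit Types (x y r : R) (h g u : R -> R).
Local Notation arcI h := (arc.-integrable setT (EFin \o h)).
Local Notation Nr r h := ('N[arc]_r%:E[EFin \o h])%E.

Lemma ae_arc_itv : {ae (@arc R), forall x, 0 < x < 2 * pi}.
Proof.
pose I : set (measurableTypeR R) := `]0, (2 * pi)[%classic.
have mI : measurable I by exact: measurable_itv.
have pI : arc I = 1%E.
  rewrite /arc /uniform_prob (eq_integral (fun=> ((2 * pi - 0)^-1 : R)%:E)); last first.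
    move=> x; rewrite inE /I /= in_itv /= => /andP[x0 x1].
    by rewrite /uniform_pdf !ltW.
  rewrite integral_cst//= /I lebesgue_measure_itv /= lte_fin two_pi_gt0.
  by rewrite sube0 subr0 -EFinM mulVf// gt_eqF// two_pi_gt0.
exists (~` I); split.
- exact: measurableC.
- rewrite -[LHS]/(uniform_prob (@two_pi_gt0 R) (~` I)) probability_setC//.
  by rewrite [X in (1 - X)%E]pI subee.
- by move=> x /= /negP h; apply/negP; move: h; rewrite /I /= in_itv.
Qed.

Lemma chord2E y x : normc (cis y - cis x) ^+ 2 = 2 - 2 * cos (y - x).
Proof.
rewrite /= sqr_sqrtr ?addr_ge0 ?sqr_ge0// cosB.
by have := cos2Dsin2 y; have := cos2Dsin2 x; nra.
Qed.

(** Near y use continuity; away from y the chord is bounded below, so that a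
    multiple of its square dominates the bounded function. The endpoints 0 and
    2 pi are excluded because h is not assumed periodic. *)
Lemma continuous_chord_bound h (M eps : R) y : continuous h ->
  (forall x, `|h x| <= M) -> 0 < y < 2 * pi -> 0 < eps ->
  exists2 C, 0 <= C & forall x, 0 < x < 2 * pi ->
    `|h x - h y| <= eps + C * normc (cis y - cis x) ^+ 2.
Proof.
move=> ch hM /andP[y0 y2] e0.
have M0 : 0 <= M by apply: le_trans (hM 0).
have [d d0 hd] : exists2 d, 0 < d & forall x, `|x - y| < d -> `|h x - h y| <= eps.
  have /cvgrPdist_le /(_ eps e0) := ch y.
  move=> /nbhs_ballP[d /= d0 hd]; exists d => // x xy.
  by rewrite distrC; apply: hd; rewrite /ball /= distrC.
(* d1 also keeps both arcs from x to y longer than d1 *)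
pose d1 := Num.min d (Num.min y (2 * pi - y)).
have d10 : 0 < d1 by rewrite /d1 !lt_min d0 y0 subr_gt0.
have d1y : d1 <= y by rewrite /d1 !ge_min lexx orbT.
have d1y' : d1 <= 2 * pi - y by rewrite /d1 !ge_min lexx !orbT.
have d1d : d1 <= d by rewrite /d1 !ge_min lexx.
have d1pi : d1 <= pi by lra.
have cd : cos d1 < 1.
  by rewrite -cos0 ltr_cos ?in_itv/= ?lexx ?pi_ge0 ?(ltW d10).
exists (2 * M / (2 - 2 * cos d1)); first by rewrite divr_ge0//; lra.
move=> x /andP[x0 x2]; rewrite chord2E.
have [xy|xy] := ltP `|x - y| d1.
  apply: le_trans (hd _ (lt_le_trans xy d1d)) _.
  by rewrite lerDl mulr_ge0 ?divr_ge0 ?mulr_ge0//.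
have cxy : cos (y - x) <= cos d1.
  have -> : cos (y - x) = cos `|x - y|.
    have [h0|/ltW h0] := leP 0 (x - y); first by rewrite ger0_norm// -cosN opprB.
    by rewrite ler0_norm// opprB.
  have [xp|xp] := leP `|x - y| pi.
    by rewrite leNgt ltr_cos -?leNgt ?in_itv/= ?d1pi ?(ltW d10) ?normr_ge0 ?xp.
  have -> : cos `|x - y| = cos (2 * pi - `|x - y|).
    by have := congr1 (@complex.Re R) (cis_2piB `|x - y|) => /= ->; rewrite cosN.
  have xl : `|x - y| <= 2 * pi - d1 by rewrite ler_norml; lra.
  rewrite leNgt ltr_cos -?leNgt ?in_itv/= ?d1pi ?(ltW d10)//; lra.
have hh : `|h x - h y| <= 2 * M.
  by apply: le_trans (ler_normB _ _) _; have := hM x; have := hM y; lra.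
apply: le_trans hh _; apply: (@le_trans _ _ (2 * M / (2 - 2 * cos d1) * (2 - 2 * cos (y -
  x)))); last by rewrite lerDr ltW.
rewrite -mulrA ler_peMr ?mulr_ge0// ler_pdivlMl; first by lra.
by lra.
Qed.

Lemma fejer_mean_bounded n h (M : R) y : measurable_fun setT h ->
  (forall x, `|h x| <= M) -> `|fejer_mean n h y| <= M.
Proof.
move=> mh hM; have ih := integrable_bounded mh hM.
apply: le_trans (fejer_mean_le n y ih) _.
rewrite -[leRHS](fejer_mean_cst n M y) /fejer_mean; apply: le_Rintegral => //.
- exact: (integrable_mul_kernel n y (arcI_normr ih)).
- apply: (@integrable_mul_kernel R n y (fun=> M)).
  by apply: (@integrable_bounded _ _ `|M|); [exact: measurable_cst|].
- by move=> x _; rewrite ler_wpM2l ?fejer_kernel_ge0.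
Qed.

(** Integrating the chord bound against the kernel: the first term contributes
    eps / 2, since the kernel has mean one, and the second O(1 / n), by the
    telescoping bound. *)
Lemma fejer_mean_pointwise h (M eps : R) y : continuous h ->
  (forall x, `|h x| <= M) -> 0 < y < 2 * pi -> 0 < eps ->
  \forall n \near \oo, `|fejer_mean n h y - h y| <= eps.
Proof.
move=> ch hM yI e0.
have mh : measurable_fun setT h by exact: measurable_realfun.continuous_measurable_fun.
have ih := integrable_bounded mh hM.
have icst (c : R) : arcI (fun=> c).
  by apply: (@integrable_bounded _ _ `|c|); [exact: measurable_cst|].
have e20 : 0 < eps / 2 by rewrite divr_gt0.
have [C C0 hC] := continuous_chord_bound ch hM yI e20.
have bound n : `|fejer_mean n h y - h y| <= eps / 2 + 4 * C / n.+1%:R.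
  rewrite -[X in _ - X](fejer_mean_cst n (h y) y) -fejer_meanB//.
  have ihy : arcI (fun x => h x - h y) by exact: (integrableB _ ih (icst _)).
  apply: le_trans (fejer_mean_le n y ihy) _.
  have i1 := integrable_mul_kernel n y (arcI_normr ihy).
  have i2 : arcI (fun x => eps / 2 * fejer_kernel n y x + 4 * C / n.+1%:R).
    apply: (@integrableD _ _ _ arc setT measurableT (EFin \o (fun x => eps / 2 *
      fejer_kernel n y x)) _ _ (icst _)).
    exact: (integrableZl _ _ (fejer_kernel_integrable n y)).
  have -> : eps / 2 + 4 * C / n.+1%:R = \int[arc]_x (eps / 2 * fejer_kernel n y x + 4 * C /
    n.+1%:R).
    rewrite RintegralD//; last first.
      exact: (integrableZl _ _ (fejer_kernel_integrable n y)).
    rewrite (RintegralZl _ measurableT (fejer_kernel_integrable n y)).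
    rewrite integral_fejer_kernel mulr1 Rintegral_cst//.
    by rewrite (_ : _ setT = 1%E) ?mulr1//; exact: arcT.
  rewrite -lee_fin !EFin_Rintegral//; apply: ae_ge0_le_integral => //.
  - by move=> x _; rewrite lee_fin mulr_ge0 ?fejer_kernel_ge0.
  - by apply/measurable_EFinP; exact: (arcI_meas i1).
  - move=> x _; rewrite lee_fin; apply: addr_ge0; last by rewrite divr_ge0 ?mulr_ge0.
    by apply: mulr_ge0; [exact: ltW|exact: fejer_kernel_ge0].
  - by apply/measurable_EFinP; exact: (arcI_meas i2).
  - apply: filterS ae_arc_itv => x xI _; rewrite lee_fin.
    apply: (@le_trans _ _ (fejer_kernel n y x * (eps / 2 + C * normc (cis y - cis x) ^+ 2))).
      by rewrite ler_wpM2l ?fejer_kernel_ge0// hC.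
    have := ler_wpM2l C0 (fejer_kernel_chord n y x).
    by move: (fejer_kernel n y x) (normc _ ^+ 2) (n.+1%:R^-1) => k c z; nra.
near=> n; apply: le_trans (bound n) _.
suff : 4 * C / n.+1%:R <= eps / 2 by move: (4 * C / _) => w wle; rewrite [leRHS](splitr eps) lerD2l.
rewrite ler_pdivrMr// [leRHS]mulrC -ler_pdivrMr//.
near: n; exists (Num.truncn (4 * C / (eps / 2))).+1 => // n /= hn.
apply: ltW; apply: lt_le_trans (truncnS_gt _) _.
by rewrite ler_nat (leq_trans hn).
Unshelve. all: by end_near. Qed.

End fejer_convergence.

Section fejer_theorem.
Context {R : realType}.
Implicit Types (x y r : R) (h g u : R -> R).
Local Notation arcI h := (arc.-integrable setT (EFin \o h)).
Local Notation Nr r h := ('N[arc]_r%:E[EFin \o h])%E.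

Lemma Lnorm_le_integral r u (eps : R) : 0 < r -> 0 <= eps ->
  (\int[arc]_x (`|u x| `^ r)%:E <= (eps `^ r)%:E)%E -> (Nr r u <= eps%:E)%E.
Proof.
move=> r0 e0 hle; rewrite LnormE.
have -> : eps%:E = ((eps `^ r)%:E `^ r^-1)%E.
  by rewrite poweR_EFin -powRrM mulfV ?gt_eqF// powRr1.
apply: gt0_ler_poweR; rewrite ?in_itv/= ?leey ?invr_ge0 ?(ltW r0) ?lee_fin ?powR_ge0//.
by rewrite andbT; apply: integral_ge0 => x _; rewrite lee_fin powR_ge0.
Qed.

Lemma Lnorm_dominated r (u_ : nat -> R -> R) (b : R -> R) : 0 < r ->
  (forall n, measurable_fun setT (u_ n)) -> arcI b ->
  {ae arc, forall x, forall n, `|u_ n x| `^ r <= b x} ->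
  {ae arc, forall x, forall eta : R, 0 < eta -> \forall n \near \oo, `|u_ n x| <= eta} ->
  forall eps : R, 0 < eps -> \forall n \near \oo, (Nr r (u_ n) <= eps%:E)%E.
Proof.
move=> r0 mu ib ub u0 eps e0.
have := @dominated_convergence _ _ _ (uniform_prob (@two_pi_gt0 R)) setT measurableT
  (fun n x => (`|u_ n x| `^ r)%:E) (fun=> 0%E) (EFin \o b).
case.
  - by move=> n; apply/measurable_EFinP; exact: (measurable_normr_powR r (mu n)).
- exact: measurable_cst.
- apply: filterS u0 => x ux _; apply/fine_cvgP; split; first exact: nearW.
  apply/cvgrPdist_le => eta eta0.
  have := ux (eta `^ r^-1); rewrite powR_gt0// => /(_ isT).
  apply: filterS => n hn /=; rewrite sub0r normrN ger0_norm ?powR_ge0//.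
  have etaE : (eta `^ r^-1) `^ r = eta by rewrite -powRrM mulVf ?gt_eqF// powRr1// ltW.
  rewrite -[leRHS]etaE.
  by apply: ge0_ler_powR; rewrite ?nnegrE ?powR_ge0 ?(ltW r0).
- exact: ib.
- apply: filterS ub => x ux n _ /=.
  by rewrite lee_fin ger0_norm ?powR_ge0.
move=> _ _; rewrite integral0 => /fine_cvgP[fin cv].
have er0 : 0 < eps `^ r by rewrite powR_gt0.
have := cv; move=> /cvgrPdist_le /(_ _ er0) hle.
apply: filterS2 fin hle => n fn /=; rewrite sub0r normrN => hn.
apply: Lnorm_le_integral => //; first exact: ltW.
by rewrite -[leLHS]fineK// lee_fin (le_trans (ler_norm _)).
Qed.

Definition fejer_cvg r h := forall eps : R, 0 < eps -> \forall n \near \oo,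
  (Nr r (fun y => fejer_mean n h y - h y)%R <= eps%:E)%E.

Lemma integrable_cst (c : R) : arcI (fun=> c).
Proof. by apply: (@integrable_bounded _ _ `|c|); [exact: measurable_cst|]. Qed.

Lemma Lnorm_bounded r h (M : R) : 0 < r -> measurable_fun setT h -> (forall x, `|h x| <= M) ->
  (Nr r h < +oo)%E.
Proof.
move=> r0 mh hM; apply: le_lt_trans (ltry M).
have M0 : 0 <= M by apply: le_trans (hM 0).
apply: Lnorm_le_integral => //.
apply: (@le_trans _ _ (\int[arc]_x (M `^ r)%:E)%E).
  apply: ge0_le_integral => //.
  - by apply/measurable_EFinP; exact: measurable_normr_powR.
  - by move=> x _; rewrite lee_fin ge0_ler_powR// ?nnegrE// ltW.
by rewrite integral_cst//= (_ : _ setT = 1%E) ?mule1//; exact: arcT.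
Qed.

Lemma fejer_cvg_continuous r h (M : R) : 0 < r -> continuous h ->
  (forall x, `|h x| <= M) -> fejer_cvg r h.
Proof.
move=> r0 ch hM.
have mh : measurable_fun setT h by exact: measurable_realfun.continuous_measurable_fun.
have ih := integrable_bounded mh hM.
apply: (@Lnorm_dominated r _ (fun=> (M + M) `^ r)) => //.
- by move=> n; apply: measurable_funB => //; exact: fejer_mean_measurable.
- exact: integrable_cst.
- apply: aeW => x n; apply: ge0_ler_powR; rewrite ?nnegrE ?(ltW r0)//.
    by rewrite addr_ge0// (le_trans _ (hM 0)).
  by apply: le_trans (ler_normB _ _) _; rewrite lerD// fejer_mean_bounded.
- apply: filterS ae_arc_itv => x xI eta eta0.
  exact: (fejer_mean_pointwise ch hM xI eta0).
Qed.

(** The functions whose Fejer means converge are closed in L^r, because the means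
    are contractions. *)
Lemma fejer_cvg_closed r h : 1 <= r -> measurable_fun setT h -> (Nr r h < +oo)%E ->
  (forall eps : R, 0 < eps -> exists g, [/\ measurable_fun setT g, (Nr r g < +oo)%E,
     fejer_cvg r g & (Nr r (fun x => h x - g x)%R <= eps%:E)%E]) ->
  fejer_cvg r h.
Proof.
move=> r1 mh hfin happ eps e0; have r0 : 0 < r by exact: lt_le_trans r1.
have e3 : 0 < eps / 3 by rewrite divr_gt0.
have [g [mg gfin gcvg hg]] := happ _ e3.
have [ih _] := Lnorm_integrable r1 mh hfin.
have [ig _] := Lnorm_integrable r1 mg gfin.
have mhg : measurable_fun setT (fun x => h x - g x) by exact: measurable_funB.
have mgh : measurable_fun setT (fun x => g x - h x) by exact: measurable_funB.
have ihg : arcI (fun x => h x - g x) by exact: (integrableB _ ih ig).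
have hgfin : (Nr r (fun x => h x - g x)%R < +oo)%E by apply: le_lt_trans hg (ltry _).
apply: filterS (gcvg _ e3) => n hn.
have mS := fejer_mean_measurable n ihg.
have mSg : measurable_fun setT (fun y => fejer_mean n g y - g y).
  by apply: measurable_funB => //; exact: fejer_mean_measurable.
have -> : (fun y => fejer_mean n h y - h y) =
    (fejer_mean n (fun x => h x - g x) \+ ((fun y => fejer_mean n g y - g y) \+ (fun x => g
      x - h x))).
  by apply/funext => y /=; rewrite fejer_meanB//; ring.
apply: le_trans (minkowski_EFin arc mS (measurable_funD mSg mgh) r1) _.
have -> : (eps%:E = (eps / 3)%:E + ((eps / 3)%:E + (eps / 3)%:E))%E.
  by rewrite -!EFinD; congr EFin; field.
apply: leeD.
  exact: le_trans (fejer_mean_contract n r1 mhg hgfin) hg.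
apply: le_trans (minkowski_EFin arc mSg mgh r1) _.
apply: leeD => //; apply: le_trans hg; apply: le_Lnorm => //.
by apply: aeW => x; rewrite distrC.
Qed.

Definition clamp (M : R) h x := Num.max (- M) (Num.min M (h x)).

Lemma clamp_le (M : R) h x : 0 <= M -> `|clamp M h x| <= M.
Proof.
move=> M0; rewrite ler_norml /clamp.
by rewrite le_max lexx /= ge_max ge_min lexx /=; lra.
Qed.

Lemma clamp_dist (M : R) h (t : R) x : `|t| <= M -> `|t - clamp M h x| <= `|t - h x|.
Proof.
rewrite ler_norml /clamp => /andP[t1 t2].
case: (leP M (h x)) => h1; case: (leP (- M) _) => h2; rewrite //.
- rewrite !ler0_norm; lra.
- lra.
- rewrite !ger0_norm; lra.
Qed.

Lemma measurable_clamp (M : R) h : measurable_fun setT h -> measurable_fun setT (clamp M h).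
Proof.
move=> mh; apply: measurable_maxr; first exact: measurable_cst.
by apply: measurable_minr => //; exact: measurable_cst.
Qed.

(** A bounded function is an L^1 limit of continuous functions, which may be
    clamped at the same bound K; on functions bounded by 2 K the r-th power of the
    modulus is at most (2 K)^(r - 1) times the modulus, so L^1 convergence is L^r
    convergence. *)
Lemma fejer_cvg_bounded r h (M : R) : 1 <= r -> measurable_fun setT h ->
  (forall x, `|h x| <= M) -> fejer_cvg r h.
Proof.
move=> r1 mh hM0; have r0 : 0 < r by exact: lt_le_trans r1.
have M0 : 0 <= M by apply: le_trans (hM0 0).
pose K := M + 1; have K0 : 0 < K by rewrite /K ltr_wpDl.
have hK x : `|h x| <= K by rewrite (le_trans (hM0 x))// lerDl.
apply: fejer_cvg_closed => //; first exact: Lnorm_bounded hK.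
move=> eps e0.
(* L^1 accuracy that yields L^r accuracy eps for functions bounded by 2 K *)
pose D := (eps `^ r / (K + K) `^ (r - 1)).
have D0 : 0 < D by rewrite divr_gt0 ?powR_gt0// addr_gt0.
pose E : set (measurableTypeR R) := `[0, (2 * pi)]%classic.
have mE : measurable E by exact: measurable_itv.
have Efin : (lebesgue_measure E < +oo)%E.
  by rewrite /E lebesgue_measure_itv /= lte_fin two_pi_gt0 ltry.
have iE : lebesgue_measure.-integrable E (EFin \o h).
  apply: measurable_bounded_integrable => //; first exact: measurable_funTS.
  by exists K; split; [exact: num_real|move=> N KN x _; apply: le_trans (ltW KN)].
have [g_ [cg ig /fine_cvgP[gfin /cvgrPdist_le cvg0]]] :=
  approximation_continuous_integrable mE Efin iE.
have D2 : 0 < D * (2 * pi) by rewrite mulr_gt0// two_pi_gt0.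
have [n [fn hn]] : exists n, (\int[lebesgue_measure]_(z in E) `|(h z - g_ n z)%:E|)%E \is a
  fin_num /\
    (\int[lebesgue_measure]_(z in E) `|(h z - g_ n z)%:E| <= (D * (2 * pi))%:E)%E.
  have [n _ /(_ n (leqnn n)) [fn hn]] := filterI gfin (cvg0 _ D2).
  exists n; split => //; rewrite -[leLHS]fineK// lee_fin.
  by move: hn; rewrite /= sub0r normrN; apply: le_trans; exact: ler_norm.
pose g := clamp K (g_ n).
have cg' : continuous g.
  move=> x; apply: (@continuous_max R R (fun=> - K) (fun x => Num.min K (g_ n x))).
    exact: cst_continuous.
  apply: (@continuous_min R R (fun=> K) (g_ n)); first exact: cst_continuous.
  exact: cg.
have gK x : `|g x| <= K by apply: clamp_le; exact: ltW.
have mg : measurable_fun setT g by exact: measurable_realfun.continuous_measurable_fun.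
exists g; split => //; first exact: Lnorm_bounded gK.
  exact: fejer_cvg_continuous gK.
apply: Lnorm_le_integral => //; first exact: ltW.
have mgn : measurable_fun setT (g_ n) by exact: measurable_realfun.continuous_measurable_fun.
have md : measurable_fun setT (fun x => (`|h x - g_ n x|)%:E).
  by apply/measurable_EFinP; apply: measurableT_comp => //; exact: measurable_funB.
apply: (@le_trans _ _ (\int[arc]_x (((K + K) `^ (r - 1))%:E * (`|h x - g_ n x|)%:E))%E).
  apply: ge0_le_integral => //.
  - by apply/measurable_EFinP; apply: measurable_normr_powR; exact: measurable_funB.
  - by apply: measurable_funeM.
  - move=> x _; rewrite -EFinM lee_fin -(@mulr_powRB1 R `|h x - g x| r)// mulrC.
    apply: ler_pM; rewrite ?powR_ge0//; last exact: clamp_dist.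
    apply: ge0_ler_powR; rewrite ?nnegrE ?subr_ge0// ?addr_ge0 ?(ltW K0)//.
    by apply: le_trans (ler_normB _ _) _; rewrite lerD.
rewrite ge0_integralZl_EFin ?powR_ge0//.
rewrite integral_uniform//.
rewrite muleA -EFinM; apply: (@le_trans _ _ (((K + K) `^ (r - 1) * (2 * pi - 0)^-1)%:E * (D
  * (2 * pi))%:E)%E).
  apply: lee_wpmul2l; first by rewrite lee_fin mulr_ge0 ?powR_ge0// invr_ge0 subr0 ltW// two_pi_gt0.
  exact: hn.
rewrite -EFinM lee_fin subr0 /D.
have P0 : (2 * pi : R) != 0 by rewrite gt_eqF// two_pi_gt0.
have Q0 : (K + K) `^ (r - 1) != 0 by rewrite gt_eqF// powR_gt0// addr_gt0.
move: ((K + K) `^ (r - 1)) (2 * pi : R) (eps `^ r) P0 Q0 => A B C B0 A0.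
by rewrite (_ : A / B * (C / A * B) = C)//; field; rewrite A0.
Qed.

(** Truncation reduces the general case to bounded functions. *)
Lemma fejer_mean_cvg r h : 1 <= r -> measurable_fun setT h -> (Nr r h < +oo)%E ->
  fejer_cvg r h.
Proof.
move=> r1 mh hfin; have r0 : 0 < r by exact: lt_le_trans r1.
have [ih ihr] := Lnorm_integrable r1 mh hfin.
apply: fejer_cvg_closed => // eps e0.
have := @Lnorm_dominated r (fun n x => h x - clamp n%:R h x) _ r0 _ ihr.
case/(_ _ _ _ eps e0).
- by move=> n; apply: measurable_funB => //; exact: measurable_clamp.
- apply: aeW => x n; apply: ge0_ler_powR; rewrite ?nnegrE ?(ltW r0)//.
  have n0 : 0 <= n%:R :> R by [].
  rewrite /clamp; case: (leP n%:R (h x)) => h1; case: (leP (- n%:R) _) => h2.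
  + rewrite !ger0_norm; lra.
  + lra.
  + by rewrite subrr normr0.
  + rewrite !ler0_norm; lra.
- apply: aeW => x eta eta0; exists (Num.truncn `|h x|).+1 => // n /= hn.
  have hxn : `|h x| <= n%:R.
    by apply: ltW; apply: lt_le_trans (truncnS_gt _) _; rewrite ler_nat.
  apply: le_trans (clamp_dist h x hxn) _.
  by rewrite subrr normr0 ltW.
move=> n _ /(_ n (leqnn n)) hn.
have cK x : `|clamp n%:R h x| <= n%:R by exact: clamp_le.
have mc := @measurable_clamp n%:R _ mh.
exists (clamp n%:R h); split => //; first exact: Lnorm_bounded cK.
exact: fejer_cvg_bounded cK.
Qed.

End fejer_theorem.

(** * Uniqueness, products and density through Fejer sums *)

Section fejer_sums.
Context {R : realType}.
Implicit Types (f g : cfun R) (r : R).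
Notation N r f := (Lp_norm r%:E f).

(** The Cesaro mean of the Fourier series, written as a double sum because that
    form is the expansion of the squared geometric sum in the kernel. *)
Definition fejer_sum (n : nat) f : cfun R := fun t =>
  \sum_(j < n.+1) \sum_(k < n.+1)
    n.+1%:R^-1 * fourier f (j%:Z - k%:Z) * t ^ (j%:Z - k%:Z).

Lemma fejer_kernel_complex n (x y : R) :
  \sum_(j < n.+1) \sum_(k < n.+1) n.+1%:R^-1 * cis y ^ (j%:Z - k%:Z) * cis x ^ (- (j%:Z - k%:Z))
  = (fejer_kernel n y x)%:C.
Proof.
have E (j k : 'I_n.+1) : n.+1%:R^-1 * cis y ^ (j%:Z - k%:Z) * cis x ^ (- (j%:Z - k%:Z)) =
    (n.+1%:R^-1 : R)%:C * cis ((j%:Z - k%:Z)%:~R * (y - x)).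
  rewrite !cis_exp -mulrA -cisD fmorphV rmorph_nat; congr (_ * cis _).
  by rewrite mulrBr mulrNz mulNr.
under eq_bigr do under eq_bigr do rewrite E.
under eq_bigr do rewrite -mulr_sumr.
rewrite -mulr_sumr /fejer_kernel rmorphM; congr (_ * _).
move: (y - x) => u; apply/eqP; rewrite eq_complex raddf_sum /=.
under eq_bigr do rewrite raddf_sum /=.
rewrite eqxx /= raddf_sum; under eq_bigr do rewrite raddf_sum /=.
(* the imaginary parts cancel in pairs (j, k), (k, j) *)
set S := (\sum_(j < _) _)%R; have : S = - S.
  rewrite /S [LHS]exchange_big -sumrN; apply: eq_bigr => j _.
  by rewrite -sumrN; apply: eq_bigr => k _; rewrite -sinN -mulNr -mulrNz opprB.
by move=> h; apply/eqP; move: S h => S; lra.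
Qed.

Lemma fejer_sumE n f (y : R) : Lp 1 f -> fejer_sum n f (cis y) =
  fejer_mean n (fun x => complex.Re (f (cis x))) y +i*
  fejer_mean n (fun x => complex.Im (f (cis x))) y.
Proof.
move=> lf.
pose H (j k : 'I_n.+1) : cfun R :=
  cscale (n.+1%:R^-1 * cis y ^ (j%:Z - k%:Z)) (f \* cpow (- (j%:Z - k%:Z))).
have lH j k : Lp 1 (H j k) by apply: LpZ => //; exact: L1_cpow.
have lHs j : Lp 1 (fun t => \sum_(k < n.+1) H j k t) by exact: L1_sum.
have -> : fejer_sum n f (cis y) = cmean (fun t => \sum_(j < n.+1) \sum_(k < n.+1) H j k t).
  rewrite (cmean_sum _ lHs); apply: eq_bigr => j _.
  rewrite (cmean_sum _ (lH j)); apply: eq_bigr => k _.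
  by rewrite [RHS]cmeanZ; [rewrite mulrAC|exact: L1_cpow].
have HE (x : R) : \sum_(j < n.+1) \sum_(k < n.+1) H j k (cis x) =
  f (cis x) * (fejer_kernel n y x)%:C.
  rewrite -fejer_kernel_complex mulr_sumr; apply: eq_bigr => j _.
  rewrite mulr_sumr; apply: eq_bigr => k _.
  by rewrite /H /cscale /cpow /=; ring.
rewrite /cmean /fejer_mean; congr (_ +i* _); apply: eq_Rintegral => x _; rewrite HE.
  by case: (f _) => a b /=; rewrite mulr0 subr0 mulrC.
by case: (f _) => a b /=; rewrite mulr0 add0r mulrC.
Qed.

Lemma Loo_fejer_sum n f : Lp +oo%E (fejer_sum n f).
Proof.
apply: Loo_sum => j; apply: Loo_sum => k.
by apply: (@LooM _ (fun _ : R[i] => n.+1%:R^-1 * fourier f (j%:Z - k%:Z)));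
  [exact: Loo_cst|exact: Loo_cpow].
Qed.

Theorem fejer_sum_cvg r f : 1 <= r -> Lp r%:E f -> forall eps : R, 0 < eps ->
  \forall n \near \oo, (N r (fejer_sum n f \- f)%R <= eps%:E)%E.
Proof.
move=> r1 lf eps e0; have r0 : 0 < r by exact: lt_le_trans r1.
have [f1 f2 f3] := lf; have mf := Lp_meas lf.
have l1 := Lp_L1 r1 lf.
have e20 : 0 < eps / 2 by rewrite divr_gt0.
pose u x := complex.Re (f (cis x)); pose v x := complex.Im (f (cis x)).
have ufin : ('N[arc]_r%:E[EFin \o u] < +oo)%E.
  apply: le_lt_trans f3; apply: le_Lnorm => //; first exact: cmeas_normc.
  by apply: aeW => x; rewrite normr_normc normc_Re.
have vfin : ('N[arc]_r%:E[EFin \o v] < +oo)%E.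
  apply: le_lt_trans f3; apply: le_Lnorm => //; first exact: cmeas_normc.
  by apply: aeW => x; rewrite normr_normc normc_Im.
have cu := fejer_mean_cvg r1 f1 ufin e20; have cv := fejer_mean_cvg r1 f2 vfin e20.
apply: filterS2 cu cv => n hu hv.
have mS (w : R -> R) : measurable_fun setT w -> ('N[arc]_r%:E[EFin \o w] < +oo)%E ->
    measurable_fun setT (fun y => `|fejer_mean n w y - w y|).
  move=> mw wfin; apply: measurableT_comp => //; apply: measurable_funB => //.
  by apply: fejer_mean_measurable; have [] := Lnorm_integrable r1 mw wfin.
have abs_norm (w : R -> R) : ('N[arc]_r%:E[EFin \o (fun y => `|w y|%R)] =
  'N[arc]_r%:E[EFin \o w])%E.
  by rewrite -[RHS]Lnorm_abse.
have -> : (eps%:E = (eps / 2)%:E + (eps / 2)%:E)%E by rewrite -EFinD -splitr.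
apply: le_trans (leeD hu hv).
rewrite -(abs_norm (fun y => fejer_mean n u y - u y)) -(abs_norm (fun y => fejer_mean n v y - v y)).
apply: le_trans (minkowski_EFin arc (mS u f1 ufin) (mS v f2 vfin) r1).
apply: le_Lnorm => //.
- apply: cmeas_normc; apply: cmeasB => //; exact: Lp_meas (Loo_fejer_sum _ _).
- by apply: measurable_funD; exact: mS.
apply: aeW => x; rewrite normr_normc /= fejer_sumE//.
apply: le_trans (ler_norm _); apply: le_trans (normc_le_Re_Im _) _.
by rewrite /u /v; case: (f (cis x)).
Qed.

Lemma fejer_sum0 n f (x : R) : (forall m, fourier f m = 0) -> fejer_sum n f (cis x) = 0.
Proof.
move=> f0; rewrite /fejer_sum big1// => j _; rewrite big1// => k _.
by rewrite f0 mulr0 mul0r.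
Qed.

Lemma ereal_le_eps (z : \bar R) : (forall eps : R, 0 < eps -> (z <= eps%:E)%E) -> (z <= 0)%E.
Proof.
by move=> h; apply/lee_addgt0Pr => e e0; rewrite add0e; exact: h.
Qed.

(** All Fejer sums of the difference vanish, and they converge to it. *)
Theorem fourier_inj f g : Lp 1 f -> Lp 1 g -> (forall n, fourier f n = fourier g n) ->
  ae_circle f g.
Proof.
move=> lf lg fg.
have lh : Lp 1 (f \- g) by exact: LpB.
have h0 m : fourier (f \- g) m = 0 by rewrite fourierB// fg subrr.
have mh := Lp_meas lh.
have N0 : N 1 (f \- g)%R = 0%E.
  apply/eqP; rewrite eq_le Lp_norm_ge0 andbT; apply: ereal_le_eps => eps e0.
  have [n _ /(_ n (leqnn n)) hn] := fejer_sum_cvg (lexx 1) lh e0.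
  apply: le_trans hn; apply: Lp_norm_le => //.
    by apply: cmeasB => //; exact: Lp_meas (Loo_fejer_sum _ _).
  by apply: aeW => x /=; rewrite fejer_sum0// sub0r -/(normc _) normcN.
have := Lp_norm_eq0 ltr01 mh N0.
by apply: filterS => x /= /eqP; rewrite subr_eq0 => /eqP.
Qed.

Lemma eq_of_eps (z w : R[i]) (C : \bar R) : (C < +oo)%E -> (0 <= C)%E ->
  (forall eps : R, 0 < eps -> ((normc (z - w))%:E <= C * eps%:E)%E) -> z = w.
Proof.
move: C => [C| |]// _ C0 h; apply/eqP; rewrite -subr_eq0 -normc_eq0.
rewrite eq_le normc_ge0 andbT -lee_fin; apply: ereal_le_eps => eps e0.
rewrite lee_fin in C0.
have C1 : 0 < C + 1 by rewrite ltr_wpDl.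
apply: le_trans (h (eps / (C + 1)) _) _; first by rewrite divr_gt0.
rewrite -EFinM lee_fin mulrA ler_pdivrMr// mulrC ler_pM2l//.
by rewrite lerDl.
Qed.

(** The convolution formula for the coefficients of a product, in the only case
    needed here: all terms but one vanish, so no convergence question arises. The
    formula is exact for every Fejer sum in place of f, since the N diagonal terms
    cancel the normalization, and passes to the limit by Hoelder's inequality. *)
Theorem fourier_prod (p q : R) f g (n : int) : 0 < p -> 0 < q -> 1 <= p -> p^-1 + q^-1 = 1 ->
  Lp p%:E f -> Lp q%:E g ->
  (forall m, m != 0 -> fourier f m * fourier g (n - m) = 0) ->
  fourier (f \* g) n = fourier f 0 * fourier g n.
Proof.
move=> p0 q0 p1 pq lf lg h.
have q1 : 1 <= q.
  rewrite -(invrK q) invf_ge1 ?invr_gt0// -pq lerDr invr_ge0 ltW//.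
have mf := Lp_meas lf; have mg := Lp_meas lg.
have lg1 := Lp_L1 q1 lg.
have lc m : Lp 1 (cpow m \* g) by apply: LpM => //; exact: Loo_cpow.
have SE N : fourier (fejer_sum N f \* g) n = fourier f 0 * fourier g n.
  pose H (j k : 'I_N.+1) : cfun R :=
    cscale (N.+1%:R^-1 * fourier f (j%:Z - k%:Z)) (cpow (j%:Z - k%:Z) \* g).
  have lH j k : Lp 1 (H j k) by apply: LpZ.
  have lHs j : Lp 1 (fun t => \sum_(k < N.+1) H j k t) by exact: L1_sum.
  transitivity (fourier (fun t => \sum_(j < N.+1) \sum_(k < N.+1) H j k t) n).
    apply: fourier_eq => x /=; rewrite /fejer_sum mulr_suml; apply: eq_bigr => j _.
    by rewrite mulr_suml; apply: eq_bigr => k _; rewrite /H /cscale /cpow /= mulrA.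
  rewrite (fourier_sum _ _ lHs).
  have HE (j k : 'I_N.+1) : fourier (H j k) n =
    N.+1%:R^-1 * (fourier f 0 * fourier g n) * (j == k)%:R.
    rewrite fourierZ// fourier_shift -[LHS]mulrA.
    have [->|jk] := eqVneq j k; first by rewrite subrr subr0 mulr1.
    rewrite h ?mulr0// subr_eq0 eqz_nat; exact: jk.
  under eq_bigr => j _.
    rewrite (fourier_sum _ _ (lH j)) (bigD1 j)//= HE eqxx mulr1 big1 ?addr0 => [|k kj]; last first.
      by rewrite HE eq_sym (negbTE kj) mulr0.
    over.
  by rewrite /= sumr_const card_ord -[LHS]mulr_natl mulVKf// pnatr_eq0.
apply: (@eq_of_eps _ _ (2%:E * N q g)%E).
- by rewrite lte_mul_pinfty//; case: lg.
- by rewrite mule_ge0 ?Lp_norm_ge0// lee_fin.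
move=> eps e0.
have [N _ /(_ N (leqnn N)) hN] := fejer_sum_cvg p1 lf e0.
have lS : Lp p%:E (fejer_sum N f) by apply: Loo_Lp => //; exact: Loo_fejer_sum.
have lfg := Lp_prod p0 q0 pq lf lg; have lSg := Lp_prod p0 q0 pq lS lg.
rewrite -(SE N) normcB -fourierB//.
apply: le_trans (normc_fourier_le _ (LpB (lexx 1) lSg lfg)) _.
rewrite -muleA lee_pmul2l//.
have -> : fejer_sum N f \* g \- f \* g = (fejer_sum N f \- f) \* g.
  by apply/funext => t /=; rewrite mulrBl.
apply: le_trans (Lp_hoelder p0 q0 pq (cmeasB (Lp_meas lS) mf) mg) _.
by rewrite muleC lee_wpmul2l// Lp_norm_ge0.
Qed.

Lemma fourier_horner (s : {poly R[i]}) (n : int) : fourier (horner s) n =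
  if n is Posz m then s`_m else 0.
Proof.
rewrite (_ : fourier (horner s) n = \sum_(i < size s) s`_i * (i%:Z == n)%:R); last first.
  pose H (i : 'I_(size s)) : cfun R := cscale s`_i (cpow i%:Z).
  have lc (m : int) : Lp 1 (@cpow R m) by apply: Loo_Lp => //; exact: Loo_cpow.
  have lH i : Lp 1 (H i) by apply: LpZ.
  transitivity (fourier (fun t => \sum_(i < size s) H i t) n).
    by apply: fourier_eq => x; rewrite horner_coef.
  rewrite (fourier_sum _ _ lH); apply: eq_bigr => i _.
  by rewrite fourierZ// fourier_cpow.
case: n => m; last by rewrite big1// => i _; rewrite mulr0.
have [ms|ms] := ltnP m (size s).
  rewrite (bigD1 (Ordinal ms))//= eqxx mulr1 big1 ?addr0// => i im.
  by rewrite eqz_nat (negbTE (im : val i != _)) mulr0.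
rewrite nth_default// big1// => i _; rewrite eqz_nat.
by rewrite ltn_eqF ?mulr0// (leq_trans (ltn_ord i)).
Qed.

(** The Fejer sums of a function without negative frequencies are polynomials. *)
Lemma poly_dense r f : 1 <= r -> Lp r%:E f -> (forall n : int, n < 0 -> fourier f n = 0) ->
  forall eps : R, 0 < eps -> exists s : {poly R[i]}, (N r (horner s \- f)%R <= eps%:E)%E.
Proof.
move=> r1 lf f0 eps e0; have r0 : 0 < r by exact: lt_le_trans r1.
have [n _ /(_ n (leqnn n)) hn] := fejer_sum_cvg r1 lf e0.
pose s : {poly R[i]} := \sum_(j < n.+1) \sum_(k < n.+1)
    (n.+1%:R^-1 * fourier f (j%:Z - k%:Z)) *: 'X^(j - k).
exists s; apply: le_trans hn; apply: Lp_norm_le => //.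
- by apply: cmeasB; [exact: Lp_meas (Loo_horner s)|exact: Lp_meas lf].
- by apply: cmeasB; [exact: Lp_meas (Loo_fejer_sum _ _)|exact: Lp_meas lf].
apply: aeW => x; rewrite [X in normc X <= _](_ : _ = (fejer_sum n f \- f) (cis x))//=.
congr (_ - _); rewrite /s /fejer_sum horner_sum; apply: eq_bigr => j _.
rewrite horner_sum; apply: eq_bigr => k _; rewrite hornerZ hornerXn.
have [kj|jk] := leqP k j; first by rewrite subzn// exprnP.
by rewrite f0 ?mulr0 ?mul0r// subr_lt0 ltz_nat.
Qed.

End fejer_sums.

Lemma ae_const {R : realType} (Q : Prop) : {ae (@arc R), forall x, Q} -> Q.
Proof.
move=> [A [mA A0 QA]]; apply: contrapT => nQ.
have : arc [set: R] = 0%E.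
  rewrite -A0; congr arc; apply/seteqP; split => // x _; exact: QA.
by rewrite arcT => -[] /eqP; rewrite oner_eq0.
Qed.

(** * The Riesz projection, Toeplitz and Hankel operators on Hardy spaces *)

Section projection.
Context {R : realType} (P : cfun R -> cfun R) (hP : riesz_projection P).
Implicit Types (f g h : cfun R) (r : R) (n : int).

Lemma P_Lp r f : 1 < r -> Lp r%:E f -> Lp r%:E (P f).
Proof. by move=> r1 lf; case: (hP r1 lf). Qed.

Lemma fourier_P r f n : 1 < r -> Lp r%:E f ->
  fourier (P f) n = if 0 <= n then fourier f n else 0.
Proof. by move=> r1 lf; case: (hP r1 lf). Qed.

(** [P f] is determined almost everywhere by its Fourier coefficients; every
    identity below that involves [P] goes through them. *)
Lemma P_eq r f g : 1 < r -> Lp r%:E f -> Lp r%:E g ->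
  (forall n, fourier g n = if 0 <= n then fourier f n else 0) -> ae_circle (P f) g.
Proof.
move=> r1 lf lg h; apply: fourier_inj.
- exact: Lp_L1 (ltW r1) (P_Lp r1 lf).
- exact: Lp_L1 (ltW r1) lg.
- by move=> n; rewrite (fourier_P _ r1 lf) h.
Qed.

Lemma Q_Lp r f : 1 < r -> Lp r%:E f -> Lp r%:E (Qproj P f).
Proof. by move=> r1 lf; apply: LpB => //; [exact: ltW|exact: P_Lp]. Qed.

Lemma fourier_Q r f n : 1 < r -> Lp r%:E f ->
  fourier (Qproj P f) n = if 0 <= n then 0 else fourier f n.
Proof.
move=> r1 lf; rewrite fourierB ?(fourier_P _ r1 lf).
- by case: ifP; rewrite ?subrr ?subr0.
- exact: Lp_L1 (ltW r1) lf.
- exact: Lp_L1 (ltW r1) (P_Lp r1 lf).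
Qed.

End projection.

Section hardy.
Context {R : realType} (P : cfun R -> cfun R) (hP : riesz_projection P).
Context (p : R) (hp : 1 < p).
Implicit Types (f g h : cfun R) (n : int).

Let p0 : 0 < p. Proof. exact: lt_trans hp. Qed.

Lemma Hp_L1 f : Hp p f -> Lp 1 f.
Proof. by case=> lf _; exact: Lp_L1 (ltW hp) lf. Qed.

Lemma Hp_D f g : Hp p f -> Hp p g -> Hp p (f \+ g).
Proof.
move=> hf hg; split; first by apply: LpD (ltW hp) _ _; [case: hf|case: hg].
move=> n n0; rewrite fourierD; [|exact: Hp_L1..].
by rewrite hf.2// hg.2// addr0.
Qed.

Lemma Hp_Z z f : Hp p f -> Hp p (cscale z f).
Proof.
move=> hf; split; first by apply: LpZ => //; case: hf.
by move=> n n0; rewrite fourierZ ?hf.2 ?mulr0//; exact: Hp_L1.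
Qed.

Lemma Hp_B f g : Hp p f -> Hp p g -> Hp p (f \- g).
Proof.
move=> hf hg; rewrite (_ : f \- g = f \+ cscale (-1) g).
  by apply: Hp_D => //; exact: Hp_Z.
by apply/funext => t; rewrite /cscale /= mulN1r.
Qed.

Lemma Hp_horner (s : {poly R[i]}) : Hp p (horner s).
Proof.
split; first exact: Loo_Lp (Loo_horner s).
by move=> [n|n] // _; rewrite fourier_horner.
Qed.

Lemma P_Hp f : Hp p f -> ae_circle (P f) f.
Proof.
move=> [lf f0]; apply: (P_eq hP hp) => // n.
by case: (leP 0 n) => // n0; rewrite f0.
Qed.

Lemma P_isHp f : Lp p%:E f -> Hp p (P f).
Proof.
move=> lf; split; first exact: P_Lp.
by move=> n n0; rewrite (fourier_P hP _ hp lf) leNgt n0.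
Qed.

Lemma Lp_mulP g f : Lp +oo%E g -> Hp p f -> Lp p%:E (g \* P f).
Proof. by move=> lg [lf _]; apply: LpM => //; exact: P_Lp. Qed.

Lemma toeplitz_Hp g f : Lp +oo%E g -> Hp p f -> Hp p (toeplitz P g f).
Proof. by move=> lg hf; apply: P_isHp; exact: Lp_mulP. Qed.

Lemma fourier_toeplitz g f n : Lp +oo%E g -> Hp p f -> 0 <= n ->
  fourier (toeplitz P g f) n = fourier (g \* f) n.
Proof.
move=> lg hf n0; rewrite (fourier_P hP _ hp (Lp_mulP lg hf)) n0.
apply: fourier_ae; first exact: Lp_meas (Lp_mulP lg hf).
  by apply: cmeasM; [exact: Lp_meas lg|case: hf => /Lp_meas].
by apply: filterS (P_Hp hf) => x /= ->.
Qed.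

Lemma flip_Lp f : Lp p%:E f -> Lp p%:E (flip f).
Proof. exact: Lp_flip. Qed.

Lemma fourier_flip_Hp f n : Hp p f -> 0 <= n -> fourier (flip f) n = 0.
Proof. by move=> hf n0; rewrite fourier_flip ?hf.2//; [lia|exact: Hp_L1]. Qed.

Lemma Hp_flip f : Lp p%:E f -> (forall n, 0 <= n -> fourier f n = 0) -> Hp p (flip f).
Proof.
move=> lf f0; split; first exact: flip_Lp.
by move=> n n0; rewrite fourier_flip ?f0//; [lia|exact: Lp_L1 (ltW hp) lf].
Qed.

Lemma Hp_flipQ f : Lp p%:E f -> Hp p (flip (Qproj P f)).
Proof.
move=> lf; apply: Hp_flip; first exact: Q_Lp.
by move=> n n0; rewrite (fourier_Q hP _ hp lf) n0.
Qed.

Lemma Q_flip f : Hp p f -> ae_circle (Qproj P (flip f)) (flip f).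
Proof.
move=> hf; have lf := flip_Lp hf.1.
have : ae_circle (P (flip f)) (horner 0).
  apply: (P_eq hP hp) => //; first exact: Loo_Lp (Loo_horner 0).
  move=> n; rewrite fourier_horner; case: (leP 0 n) => n0; last by case: n n0 => // m _;
    rewrite coef0.
  by rewrite fourier_flip_Hp//; case: n n0 => // m _; rewrite coef0.
by apply: filterS => x; rewrite /Qproj /= => ->; rewrite horner0 subr0.
Qed.

Lemma hankel_Hp g f : Lp +oo%E g -> Hp p f -> Hp p (hankel P g f).
Proof.
by move=> lg hf; apply: P_isHp; apply: LpM => //; apply: Q_Lp => //; apply: flip_Lp; case: hf.
Qed.

Lemma fourier_hankel g f n : Lp +oo%E g -> Hp p f -> 0 <= n ->
  fourier (hankel P g f) n = fourier (g \* flip f) n.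
Proof.
move=> lg hf n0.
have lff := flip_Lp hf.1.
have lQ : Lp p%:E (g \* Qproj P (flip f)) by apply: LpM => //; exact: Q_Lp.
rewrite (fourier_P hP _ hp lQ) n0.
apply: fourier_ae; first exact: Lp_meas lQ.
  by apply: cmeasM; [exact: Lp_meas lg|exact: Lp_meas lff].
by apply: filterS (Q_flip hf) => x /= ->.
Qed.

(** The operand of P in T(a) f + H(b) f: on H^p the inner projections disappear,
    because P f = f and Q J f = J f. *)
Definition th_sum (a b f : cfun R) : cfun R := (a \* f) \+ (b \* flip f).

Lemma th_sum_Lp a b f : Lp +oo%E a -> Lp +oo%E b -> Lp p%:E f -> Lp p%:E (th_sum a b f).
Proof.
move=> la lb lf; apply: LpD (ltW hp) _ _; apply: LpM => //; exact: flip_Lp.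
Qed.

Lemma th_sumP a b phi f : Lp +oo%E a -> Lp +oo%E b -> Hp p phi -> Hp p f ->
  ae_circle (toeplitz P a phi \+ hankel P b phi) f <->
  forall n, 0 <= n -> fourier (th_sum a b phi) n = fourier f n.
Proof.
move=> la lb hphi hf.
have hT := toeplitz_Hp la hphi; have hH := hankel_Hp lb hphi.
have hTH := Hp_D hT hH.
have l1 : Lp 1 (a \* phi) by apply: LpM => //; exact: Hp_L1.
have l2 : Lp 1 (b \* flip phi).
  by apply: LpM => //; apply: Lp_L1 (ltW hp) _; apply: flip_Lp; case: hphi.
have E n : 0 <= n -> fourier (toeplitz P a phi \+ hankel P b phi) n = fourier (th_sum a b phi) n.
  move=> n0; rewrite !fourierD//; [|exact: Hp_L1..].
  by rewrite fourier_toeplitz// fourier_hankel.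
split => [h n n0|h].
  rewrite -E//; apply: fourier_ae h; [exact: Lp_meas hTH.1|exact: Lp_meas hf.1].
apply: fourier_inj; [exact: Hp_L1..|].
move=> n; have [n0|n0] := leP 0 n; first by rewrite E// h.
by rewrite hTH.2// hf.2.
Qed.

End hardy.

(** * Consequences of a Wiener-Hopf factorization *)

Section factorization.
Context {R : realType} (P : cfun R -> cfun R) (hP : riesz_projection P).
Context (p q : R) (hp : 1 < p) (hpq : p^-1 + q^-1 = 1).
Context (g : cfun R) (lg : Lp +oo%E g) (k : nat)
  (F : wh_factorization P p q g (- k%:Z)).
Implicit Types (f h u : cfun R) (n m : int).

Lemma conj_gt1 : 1 < q.
Proof.
have p0 : 0 < p by exact: lt_trans hp.
have q0 : 0 < q^-1 by rewrite -(addrK p^-1 q^-1) [_ + p^-1]addrC hpq subr_gt0 invf_lt1.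
rewrite -invf_lt1 -?[0 < q]invr_gt0//.
by rewrite -hpq ltrDr invr_gt0.
Qed.

Let q1 : 1 < q := conj_gt1.
Let p0 : 0 < p. Proof. exact: lt_trans hp. Qed.
Let q0 : 0 < q. Proof. exact: lt_trans q1. Qed.
Let hqp : q^-1 + p^-1 = 1. Proof. by rewrite addrC. Qed.

Notation gm := (wh_minus F).
Notation gp := (wh_plus F).

Lemma wh_nonzero : {ae arc, forall x, gp (cis x) != 0 /\ gm (cis x) != 0}.
Proof.
apply: filterS2 (wh_plusV F) (wh_minusV F) => x; rewrite /cinv /cone /=.
move=> e1 e2; split; apply/eqP => e.
  by move: e1; rewrite e mul0r => /eqP; rewrite eq_sym oner_eq0.
by move: e2; rewrite e mul0r => /eqP; rewrite eq_sym oner_eq0.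
Qed.

Lemma wh_eqE : {ae arc, forall x, g (cis x) = gm (cis x) * (cis x ^ k)^-1 * gp (cis x)}.
Proof. by apply: filterS (wh_eq F) => x ->; rewrite /cpow /= invr_expz. Qed.

(** In each product of coefficients f_m h_(n-m) with n >= 0, the first factor is 0
    for m > 0 and the second for m <= 0. *)
Lemma fourier_prod_antianalytic f h n : Lp p%:E f -> Lp q%:E h ->
  (forall m, 0 < m -> fourier f m = 0) -> (forall m, 0 <= m -> fourier h m = 0) ->
  0 <= n -> fourier (f \* h) n = 0.
Proof.
move=> lf lh f0 h0 n0; rewrite (fourier_prod p0 q0 (ltW hp) hpq lf lh).
  by rewrite (h0 n)// mulr0.
move=> m m0; have [m1|m1] := ltP 0 m; first by rewrite f0// mul0r.
by rewrite h0 ?mulr0//; lia.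
Qed.

(** Write B for the extension of g_+^-1 P g_-^-1. With w = Q (g_-^-1 s), which
    has only negative frequencies, g B s = t^-k (s - g_- w), and g_- w has only
    negative frequencies as well. *)
Lemma wh_ext_fourier_poly (s : {poly R[i]}) n : 0 <= n ->
  fourier (g \* wh_ext F (horner s)) n = fourier (cpow (- k%:Z) \* horner s) n.
Proof.
move=> n0; have [Bh _ _] := wh_ext_bounded F.
have hB := Bh _ (Hp_horner hp s).
have lv : Lp q%:E (cinv gm \* horner s).
  by apply: Lp_mulC; apply: LpM => //; [exact: Loo_horner|case: (wh_minusV_Hq F)].
pose w := Qproj P (cinv gm \* horner s).
have lw : Lp q%:E w by exact: Q_Lp.
have w0 m : 0 <= m -> fourier w m = 0 by move=> m0; rewrite (fourier_Q hP _ q1 lv) m0.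
have lgm : Lp p%:E gm by case: (wh_minus_Hp F).
have lgw : Lp 1 (gm \* w) by exact: (Lp_prod p0 q0 hpq).
have ls : Lp 1 (horner s) by apply: Loo_Lp => //; exact: Loo_horner.
have lsw : Lp 1 (cpow (- k%:Z) \* (horner s \- gm \* w)).
  by apply: LpM => //; [exact: Loo_cpow|exact: LpB].
transitivity (fourier (cpow (- k%:Z) \* (horner s \- gm \* w)) n).
  apply: fourier_ae; [|exact: Lp_meas lsw|].
    by apply: cmeasM; [exact: Lp_meas lg|exact: Lp_meas hB.1].
  apply: filterS3 (wh_eq F) (wh_ext_poly F s) wh_nonzero => x e1 e2 [gp0 gm0].
  rewrite /w /Qproj /=; rewrite /= in e1 e2; rewrite e1 e2 /cinv.
  by field; rewrite gp0 gm0.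
rewrite !fourier_shift fourierB// (@fourier_prod_antianalytic gm w) ?subr0//; [|lia].
by case: (wh_minus_Hp F).
Qed.

Lemma wh_ext_sub f h : Hp p f -> Hp p h ->
  ae_circle (wh_ext F (h \- f)) (wh_ext F h \- wh_ext F f).
Proof.
move=> hf hh; have [_ Blin _] := wh_ext_bounded F.
have := Blin (-1) _ _ hf hh.
rewrite (_ : cscale (-1) f \+ h = h \- f); last first.
  by apply/funext => t; rewrite /cscale /= mulN1r addrC.
by apply: filterS => x ->; rewrite /cscale /= mulN1r addrC.
Qed.

(** Both sides depend continuously on f, by boundedness of the extension, and
    agree on the dense set of polynomials. Without density one would have to
    multiply g_- in L^p by a function that is merely integrable. *)
Lemma wh_ext_fourier f n : Hp p f -> 0 <= n ->
  fourier (g \* wh_ext F f) n = fourier (cpow (- k%:Z) \* f) n.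
Proof.
move=> hf n0; have [Bh _ [M BM]] := wh_ext_bounded F.
have /LooP[mg [G G0 gG]] := lg.
have lgf f' : Hp p f' -> Lp 1 (g \* f') by move=> h; apply: LpM => //; exact: Hp_L1 h.
have lkf f' : Hp p f' -> Lp 1 (cpow (- k%:Z) \* f').
  by move=> h; apply: LpM => //; [exact: Loo_cpow|exact: Hp_L1 h].
have N1p f' : Hp p f' -> (Lp_norm 1%:E f' <= Lp_norm p%:E f')%E.
  by move=> h; apply: Lp_norm1_le (ltW hp) _; exact: Lp_meas h.1.
pose C : R := 2 * (G * `|M|) + 2 * 1.
have C0 : 0 <= C by rewrite addr_ge0 ?mulr_ge0.
apply: (@eq_of_eps _ _ _ C%:E); [exact: ltry|by rewrite lee_fin|].
move=> eps e0; have [s hs] := poly_dense (ltW hp) hf.1 hf.2 e0.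
have hS := Hp_horner hp s.
have hD := Hp_B hp hS hf.
have hBs := Bh _ hS; have hBf := Bh _ hf.
have hBD := Bh _ hD.
have D1 : ((normc (fourier (g \* wh_ext F (horner s)) n - fourier (g \* wh_ext F f) n))%:E
    <= (2 * (G * `|M|) * eps)%:E)%E.
  rewrite -fourierB; [|exact: lgf..].
  apply: le_trans (normc_fourier_le _ (LpB (lexx 1) (lgf _ hBs) (lgf _ hBf))) _.
  rewrite -mulrA EFinM lee_pmul2l//.
  have -> : Lp_norm 1%:E (g \* wh_ext F (horner s) \- g \* wh_ext F f) =
      Lp_norm 1%:E (g \* wh_ext F (horner s \- f)).
    apply: Lp_norm_ae => //.
    - exact: Lp_meas (LpB (lexx 1) (lgf _ hBs) (lgf _ hBf)).
    - exact: Lp_meas (lgf _ hBD).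
    - by apply: filterS (wh_ext_sub hf hS) => x /= ->; rewrite mulrBr.
  apply: le_trans (Lp_normM ltr01 (Lp_meas hBD.1) mg G0 gG) _.
  rewrite -mulrA EFinM; apply: lee_wpmul2l; first by rewrite lee_fin.
  apply: le_trans (N1p _ hBD) _; apply: le_trans (BM _ hD) _.
  apply: (@le_trans _ _ (`|M|%:E * Lp_norm p%:E (horner s \- f)%R)%E).
    by apply: lee_wpmul2r; rewrite ?Lp_norm_ge0// lee_fin ler_norm.
  by rewrite EFinM; apply: lee_wpmul2l; rewrite ?lee_fin.
have D2 : ((normc (fourier (cpow (- k%:Z) \* horner s) n - fourier (cpow (- k%:Z) \* f) n))%:E
    <= (2 * 1 * eps)%:E)%E.
  rewrite -fourierB; [|exact: lkf..].
  apply: le_trans (normc_fourier_le _ (LpB (lexx 1) (lkf _ hS) (lkf _ hf))) _.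
  rewrite -mulrA EFinM lee_pmul2l//.
  have -> : cpow (- k%:Z) \* horner s \- cpow (- k%:Z) \* f = cpow (- k%:Z) \* (horner s \- f).
    by apply/funext => t /=; rewrite mulrBr.
  apply: (@le_trans _ _ (1%:E * Lp_norm 1%:E (horner s \- f)%R)%E).
    apply: Lp_normM => //; [exact: Lp_meas hD.1|exact: cmeas_cpow|].
    by apply: aeW => x; rewrite /cpow cis_exp normc_cis.
  rewrite EFinM; apply: lee_wpmul2l => //.
  exact: le_trans (N1p _ hD) hs.
apply: (@le_trans _ _ ((2 * (G * `|M|) * eps)%:E + (2 * 1 * eps)%:E)%E); last first.
  by rewrite -EFinD -EFinM lee_fin /C [leRHS]mulrDl.
apply: le_trans (leeD D1 D2); rewrite -EFinD lee_fin wh_ext_fourier_poly//.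
set z := fourier _ _; set w := fourier _ _; set m := fourier _ _.
rewrite (_ : z - w = (z - m) + (m - w)); last by rewrite addrA subrK.
by rewrite [X in _ <= X + _]normcB; exact: le_normcD.
Qed.

Lemma Tr_inv_Hp f : Hp p f -> Hp p (Tr_inv F f).
Proof.
move=> hf; have [Bh _ _] := wh_ext_bounded F.
by apply: Bh; apply: toeplitz_Hp => //; exact: Loo_cpow.
Qed.

(** In terms of Fourier coefficients: [Tr_inv] is a right inverse of T(g). *)
Lemma fourier_Tr_inv f n : Hp p f -> 0 <= n ->
  fourier (g \* Tr_inv F f) n = fourier f n.
Proof.
move=> hf n0; rewrite /Tr_inv wh_ext_fourier//; last first.
  by apply: toeplitz_Hp => //; exact: Loo_cpow.
rewrite fourier_shift (fourier_toeplitz hP hp)//; [|exact: Loo_cpow|lia].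
by rewrite fourier_shift; congr fourier; lia.
Qed.

(** If g f has only negative frequencies then g_+ f = t^k g_-^-1 (g f) has its
    frequencies in [0, k): those below 0 vanish by the left-hand side, those from
    k on by the right-hand side. *)
Lemma wh_kernel f : Hp p f -> (forall n, 0 <= n -> fourier (g \* f) n = 0) ->
  exists u : {poly R[i]}, (size u <= k)%N /\ ae_circle f (cinv gp \* horner u).
Proof.
move=> hf gf0.
have lgf : Lp p%:E (g \* f) by apply: LpM => //; case: hf.
have lgp : Lp q%:E gp by case: (wh_plus_Hq F).
have lx : Lp 1 (gp \* f) by apply: (Lp_prod q0 p0 hqp) => //; case: hf.
have lmi : Lp q%:E (cinv gm) by case: (wh_minusV_Hq F).
have ly : Lp 1 (cinv gm \* (g \* f)) by exact: (Lp_prod q0 p0 hqp).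
have lty : Lp 1 (cpow k%:Z \* (cinv gm \* (g \* f))) by apply: LpM => //; exact: Loo_cpow.
have xy : ae_circle (gp \* f) (cpow k%:Z \* (cinv gm \* (g \* f))).
  apply: filterS2 wh_nonzero wh_eqE => x [gp0 gm0] e.
  rewrite /cpow /cinv /= e; field.
  by rewrite expfz_neq0 ?cis_neq0// gm0.
have xE n : fourier (gp \* f) n = fourier (cinv gm \* (g \* f)) (n - k%:Z).
  by rewrite (fourier_ae _ (Lp_meas lx) (Lp_meas lty) xy) fourier_shift.
have xhigh n : k%:Z <= n -> fourier (gp \* f) n = 0.
  move=> kn; rewrite xE (fourier_prod q0 p0 (ltW q1) hqp lmi lgf).
    by rewrite (gf0 (n - k%:Z)) ?mulr0//; lia.
  move=> m m0; have [m1|m1] := ltP 0 m; first by rewrite (wh_minusV_Hq F).2// mul0r.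
  by rewrite gf0 ?mulr0//; lia.
have xlow n : n < 0 -> fourier (gp \* f) n = 0.
  move=> n0; rewrite (fourier_prod q0 p0 (ltW q1) hqp lgp hf.1).
    by rewrite hf.2// mulr0.
  move=> m m0; have [m1|m1] := ltP m 0; first by rewrite (wh_plus_Hq F).2// mul0r.
  by rewrite hf.2 ?mulr0//; lia.
exists (\poly_(i < k) fourier (gp \* f) i%:Z); split; first exact: size_poly.
have : ae_circle (gp \* f) (horner (\poly_(i < k) fourier (gp \* f) i%:Z)).
  apply: fourier_inj => //; first by apply: Loo_Lp => //; exact: Loo_horner.
  move=> n; rewrite fourier_horner; case: n => n; last by rewrite xlow.
  by rewrite coef_poly; case: ltnP => // kn; rewrite xhigh.
apply: filterS2 wh_nonzero => x [gp0 _] /= <-.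
by rewrite /cinv mulKf.
Qed.

Lemma Hp_wh_poly (u : {poly R[i]}) : Hp p (cinv gp \* horner u).
Proof.
have [lV V0] := wh_plusV_Hp F.
split; first by apply: Lp_mulC; apply: LpM => //; exact: Loo_horner.
have lu : Lp q%:E (horner u) by apply: Loo_Lp => //; exact: Loo_horner.
have hu := (Hp_horner hp u).2.
move=> n n0; rewrite (fourier_prod p0 q0 (ltW hp) hpq lV lu).
  by rewrite hu// mulr0.
move=> m m0; have [m1|m1] := ltP m 0; first by rewrite V0// mul0r.
by rewrite hu ?mulr0//; lia.
Qed.

Section signature.
Hypothesis gg : ae_circle (g \* tilde g) cone.

(** Separating variables in g (g o 1/t) = 1 gives g_+ (g_- o 1/t) =
    g_-^-1 (g_+^-1 o 1/t). The left side has no negative and the right side no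
    positive frequencies, so both are the constant g_+(0) g_-(oo) = s; multiplying
    them after a reflection gives s^2 = 1. *)
Lemma wh_signature : signature F ^+ 2 = 1 /\
  {ae arc, forall x, gm (cis x) * gp (cis x)^-1 = signature F}.
Proof.
set s := signature F.
have [lgp gp0] := wh_plus_Hq F; have [lgm gm0] := wh_minus_Hp F.
have [lgpV gpV0] := wh_plusV_Hp F; have [lgmV gmV0] := wh_minusV_Hq F.
have lx : Lp 1 (gp \* tilde gm) by apply: (Lp_prod q0 p0 hqp) => //; exact: Lp_tilde.
have ly : Lp 1 (cinv gm \* tilde (cinv gp)) by apply: (Lp_prod q0 p0 hqp) => //; exact: Lp_tilde.
have nzt : {ae arc, forall x, gp (cis x)^-1 != 0 /\ gm (cis x)^-1 != 0}.
  by apply: filterS (@ae_refl_angle R _ wh_nonzero) => x; rewrite cis_refl_angle.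
have eqt : {ae arc, forall x, g (cis x)^-1 =
    gm (cis x)^-1 * ((cis x)^-1 ^ k)^-1 * gp (cis x)^-1}.
  by apply: filterS (@ae_refl_angle R _ wh_eqE) => x; rewrite cis_refl_angle.
have xy : ae_circle (gp \* tilde gm) (cinv gm \* tilde (cinv gp)).
  apply: filterS3 (filterI wh_nonzero nzt) (filterI wh_eqE eqt) gg => x [[a0 b0]].
  move=> -[a1 b1] [e1 e2]; rewrite /cone /tilde /cinv /= e1 e2 => h.
  have t0 : cis x ^ k != 0 by rewrite expfz_neq0// cis_neq0.
  have tV : (cis x)^-1 ^ k = (cis x ^ k)^-1 by rewrite exprz_inv invr_expz.
  move: h; rewrite tV; move: (cis x ^ k) t0 => T T0 h.
  apply: (mulfI b0); apply: (mulfI a1); rewrite mulrCA mulVKf ?mulfV//.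
  by rewrite -h invrK; field.
have fx n : fourier (gp \* tilde gm) n = if n == 0 then s else 0.
  have [n0|n0] := ltP n 0; rewrite ?(gt_eqF n0) ?(lt_eqF n0).
    rewrite (fourier_prod q0 p0 (ltW q1) hqp lgp (Lp_tilde lgm)).
      rewrite fourier_tilde ?gm0 ?mulr0//; [lia|exact: Lp_L1 (ltW hp) lgm].
    move=> m m0; have [m1|m1] := ltP m 0; first by rewrite gp0// mul0r.
    by rewrite fourier_tilde ?gm0 ?mulr0//; [lia|exact: Lp_L1 (ltW hp) lgm].
  have [->|n1] := eqVneq n 0.
    rewrite (fourier_prod q0 p0 (ltW q1) hqp lgp (Lp_tilde lgm)).
      rewrite fourier_tilde; last exact: Lp_L1 (ltW hp) lgm.
      by rewrite oppr0 (wh_minus_infty F) mulr1.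
    move=> m m0; have [m1|m1] := ltP m 0; first by rewrite gp0// mul0r.
    by rewrite fourier_tilde ?gm0 ?mulr0//; [lia|exact: Lp_L1 (ltW hp) lgm].
  rewrite (fourier_ae _ (Lp_meas lx) (Lp_meas ly) xy).
  have lgpVt := Lp_tilde lgpV; have lgpV1 := Lp_L1 (ltW hp) lgpV.
  rewrite (fourier_prod q0 p0 (ltW q1) hqp lgmV lgpVt).
    by rewrite fourier_tilde ?gpV0 ?mulr0//; lia.
  move=> m m0; have [m1|m1] := ltP 0 m; first by rewrite gmV0// mul0r.
  by rewrite fourier_tilde ?gpV0 ?mulr0//; lia.
have xs : ae_circle (gp \* tilde gm) (horner s%:P).
  apply: fourier_inj => //; first by apply: Loo_Lp => //; exact: Loo_horner.
  move=> n; rewrite fx fourier_horner; case: n => n; last by [].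
  by rewrite coefC eqz_nat.
have xst : {ae arc, forall x, gm (cis x) * gp (cis x)^-1 = s}.
  apply: filterS (ae_tilde xs) => x.
  by rewrite /tilde /= invrK hornerC mulrC.
split => //; apply: (@ae_const R).
apply: filterS3 xs xst (filterI xy (filterI wh_nonzero nzt)) => x.
rewrite /= hornerC => e1 e2 [e3 [[a0 b0] [a1 b1]]].
rewrite expr2 -{1}e1 -e2 e3 /cinv /tilde /=; field.
by rewrite b0 a1.
Qed.
End signature.

End factorization.

(** * The polynomials in the solution formula *)

Section symmetric_polynomials.
Context {R : realType} (e s : R[i]) (k : nat).
Hypothesis es2 : (e * s) ^+ 2 = 1.
Implicit Types (t : R[i]) (u : {poly R[i]}).

Definition ufun_poly (j : nat) : {poly R[i]} :=
  let m := k./2 in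
  if odd k then 'X^(m + j) + (e * s) *: 'X^(m - j)
  else 'X^(m - j - 1) + (e * s) *: 'X^(m + j).

Lemma ufunE (j : nat) t : ufun e s k j t = (ufun_poly j).[t].
Proof.
by rewrite /ufun /ufun_poly; case: odd; rewrite hornerD hornerZ !hornerXn.
Qed.

Lemma usumE (r : 'I_(nb_terms k) -> R[i]) : usum e s r = horner (\sum_j r j *: ufun_poly j).
Proof.
apply/funext => t; rewrite /usum /lincomb horner_sum.
by apply: eq_bigr => j _; rewrite hornerZ ufunE.
Qed.

(** The two parities of k in the definition of [ufun] have the common form
    t^i + e s t^(k-1-i), the symmetrization of a monomial under t^i -> t^(k-1-i). *)
Lemma ufun_exponents (j : nat) : (j < nb_terms k)%N -> exists i,
  (i < k)%N /\ forall t, ufun e s k j t = t ^+ i + e * s * t ^+ (k.-1 - i).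
Proof.
rewrite /nb_terms /ufun; case: ifP => ok jk.
- exists (k./2 + j)%N; split; first by lia.
  by move=> t; congr (_ + _ * t ^+ _); lia.
- exists (k./2 - j - 1)%N; split; first by lia.
  by move=> t; congr (_ + _ * t ^+ _); lia.
Qed.

Lemma usum_sym (r : 'I_(nb_terms k) -> R[i]) t : t != 0 ->
  usum e s r t = e * s * t ^ (k%:Z - 1) * usum e s r t^-1.
Proof.
move=> t0; rewrite /usum /lincomb mulr_sumr; apply: eq_bigr => j _.
have [i [ik uE]] := ufun_exponents (ltn_ord j).
rewrite !uE mulrCA; congr (_ * _).
have -> : t ^ (k%:Z - 1) = t ^+ i * t ^+ (k.-1 - i).
  by rewrite -exprD (_ : k%:Z - 1 = (i + (k.-1 - i))%N%:Z)//; lia.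
rewrite !exprVn; have := expf_neq0 i t0; have := expf_neq0 (k.-1 - i) t0.
move: (t ^+ i) (t ^+ (k.-1 - i)) => x y y0 x0.
transitivity ((e * s) ^+ 2 * x + e * s * y); first by rewrite es2 mul1r.
by field; rewrite x0 y0.
Qed.

(** A polynomial with u_i = e s u_(k-1-i) is half the sum of the symmetrized
    monomials u_i (t^i + e s t^(k-1-i)), and each of these is [ufun] up to the
    sign e s. *)
Lemma usum_span u : (size u <= k)%N ->
  (forall i, (i < k)%N -> u`_i = e * s * u`_(k.-1 - i)) ->
  exists r : 'I_(nb_terms k) -> R[i], horner u = usum e s r.
Proof.
move=> uk us.
pose S (i : 'I_k) t := t ^+ i + e * s * t ^+ (k.-1 - i).
have single (j : 'I_(nb_terms k)) (c : R[i]) : exists r : 'I_(nb_terms k) -> R[i],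
    forall t, usum e s r t = c * ufun e s k j t.
  exists (fun j' => if j' == j then c else 0) => t.
  rewrite /usum /lincomb (bigD1 j)//= eqxx big1 ?addr0// => j' /negbTE ->.
  by rewrite mul0r.
have Sspan (i : 'I_k) : exists r : 'I_(nb_terms k) -> R[i], forall t, usum e s r t = S i t.
  have ik := ltn_ord i.
  have swap t : S i t = e * s * (t ^+ (k.-1 - i) + e * s * t ^+ i).
    by rewrite /S mulrDr mulrA -expr2 es2 mul1r addrC.
  case ok : (odd k); [have [mi|im] := leqP k./2 i | have [mi|im] := leqP k./2 i].
  - have jk : (i - k./2 < nb_terms k)%N by rewrite /nb_terms ok; lia.
    have [r rE] := single (Ordinal jk) 1; exists r => t.
    by rewrite rE mul1r /ufun ok /S; congr (_ ^+ _ + _ * _ ^+ _) => /=; lia.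
  - have jk : (k./2 - i < nb_terms k)%N by rewrite /nb_terms ok; lia.
    have [r rE] := single (Ordinal jk) (e * s); exists r => t.
    by rewrite rE swap /ufun ok; congr (_ * (_ ^+ _ + _ * _ ^+ _)) => /=; lia.
  - have jk : (i - k./2 < nb_terms k)%N by rewrite /nb_terms ok; lia.
    have [r rE] := single (Ordinal jk) (e * s); exists r => t.
    by rewrite rE swap /ufun ok; congr (_ * (_ ^+ _ + _ * _ ^+ _)) => /=; lia.
  - have jk : (k./2 - i - 1 < nb_terms k)%N by rewrite /nb_terms ok; lia.
    have [r rE] := single (Ordinal jk) 1; exists r => t.
    by rewrite rE mul1r /ufun ok /S; congr (_ ^+ _ + _ * _ ^+ _) => /=; lia.
have [rr rrE] := choice Sspan.
pose r (j : 'I_(nb_terms k)) : R[i] := \sum_(i < k) u`_i / 2 * rr i j.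
exists r; apply/funext => t.
have -> : usum e s r t = \sum_(i < k) u`_i / 2 * S i t.
  rewrite /usum /lincomb /r.
  under eq_bigr do rewrite mulr_suml.
  rewrite exchange_big; apply: eq_bigr => i _; rewrite -rrE /usum /lincomb mulr_sumr.
  by apply: eq_bigr => j _; rewrite mulrA.
have two0 : (2 : R[i]) != 0 by rewrite pnatr_eq0.
apply: (mulfI two0); rewrite mulr_sumr.
rewrite (horner_coef_wide _ uk) mulr_natl mulr2n {2}(reindex_inj rev_ord_inj) -big_split /=.
apply: eq_bigr => i _; have ik := ltn_ord i.
have ii : (k.-1 - (k.-1 - i) = i)%N by lia.
rewrite -subn1 -subnDA add1n in ii *.
rewrite (us (k - i.+1)%N); last by lia.
rewrite (_ : (k.-1 - (k - i.+1) = i)%N); last by lia.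
rewrite /S (_ : (k.-1 - i = k - i.+1)%N); last by lia.
by field.
Qed.

End symmetric_polynomials.

(** * Flips of the kernel functions *)

Section flip_symmetry.
Context {R : realType} (P : cfun R -> cfun R) (hP : riesz_projection P).
Context (p q : R) (hp : 1 < p) (hpq : p^-1 + q^-1 = 1).
Context (g : cfun R) (lg : Lp +oo%E g) (k : nat)
  (F : wh_factorization P p q g (- k%:Z)).
Hypothesis gg : ae_circle (g \* tilde g) cone.
Variable e : R[i].
Hypothesis e2 : e ^+ 2 = 1.
Notation gm := (wh_minus F).
Notation gp := (wh_plus F).
Notation s := (signature F).

Let s2 : s ^+ 2 = 1. Proof. by have [] := wh_signature hp hpq F gg. Qed.

Lemma signature_es2 : (e * s) ^+ 2 = 1.
Proof. by rewrite exprMn e2 s2 mulr1. Qed.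

(** Since (g_+ o 1/t)^-1 = s g_-, the flip of g_+^-1 v is s t^-1 g_- v(1/t), while
    e g g_+^-1 v is e t^-k g_- v(t). *)
Lemma flip_wh_poly (v : cfun R) :
  {ae arc, forall x, (flip (cinv gp \* v) (cis x) = e * (g \* (cinv gp \* v)) (cis x)) <->
    v (cis x) = e * s * cis x ^ (k%:Z - 1) * v (cis x)^-1}.
Proof.
have [_ sE] := wh_signature hp hpq F gg.
have nzt : {ae arc, forall x, gp (cis x)^-1 != 0 /\ gm (cis x)^-1 != 0}.
  by apply: filterS (@ae_refl_angle R _ (wh_nonzero F)) => x; rewrite cis_refl_angle.
apply: filterS3 sE (wh_eqE F) (filterI (wh_nonzero F) nzt) => x e1 e3 [[a0 b0] [a1 _]].
rewrite /flip /cinv /= e3; have t0 := cis_neq0 x.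
have -> : cis x ^ (k%:Z - 1) = cis x ^ k * (cis x)^-1 by rewrite expfzDr// exprN1.
have T0 : cis x ^ k != 0 by rewrite expfz_neq0.
move: (cis x ^ k) T0 => T T0.
have gpV : (gp (cis x)^-1)^-1 = s * gm (cis x).
  by apply: (mulIf a1); rewrite mulVf// -mulrA e1 -expr2 s2.
have ee : e * e = 1 by rewrite -expr2.
rewrite gpV; move: (gm (cis x)) b0 => b b0; move: (gp (cis x)) a0 => c c0.
move: (v (cis x)) (v (cis x)^-1) => v1 v2; move: (cis x) t0 => t t0.
split => [h|->].
  rewrite -[LHS]mul1r -ee; have := congr1 (fun z => e * T * b^-1 * z) h.
  rewrite (_ : e * T * b^-1 * (e * (b / T * c * (c^-1 * v1))) = e * e * v1); last by field;
    rewrite b0 T0 c0.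
  by move=> <-; field; rewrite b0 t0.
transitivity ((e * e) * (t^-1 * (s * b * v2))); first by rewrite ee mul1r.
by field; rewrite T0 t0 c0.
Qed.

Lemma flip_wh_usum (r : 'I_(nb_terms k) -> R[i]) :
  ae_circle (flip (cinv gp \* usum e s r)) (cscale e (g \* (cinv gp \* usum e s r))).
Proof.
apply: filterS (flip_wh_poly (usum e s r)) => x [_]; apply.
by apply: usum_sym; [exact: signature_es2|exact: cis_neq0].
Qed.

Lemma wh_kernel_usum f : Hp p f -> (forall n : int, 0 <= n -> fourier (g \* f) n = 0) ->
  ae_circle (flip f) (cscale e (g \* f)) ->
  exists r : 'I_(nb_terms k) -> R[i], ae_circle f (cinv gp \* usum e s r).
Proof.
move=> hf gf0 fe.
have [u [uk fu]] := wh_kernel hp hpq lg F hf gf0.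
have usym : ae_circle (horner u) (cscale (e * s) (cpow (k%:Z - 1) \* tilde (horner u))).
  apply: filterS3 (flip_wh_poly (horner u)) fe (filterI fu (ae_flip fu)) => x [h _] fe' [fu1 fu2].
  have /h uE : flip (cinv gp \* horner u) (cis x) = e * (g \* (cinv gp \* horner u)) (cis x).
    by rewrite -fu2 fe' /cscale /= fu1.
  by rewrite uE /cscale /tilde /cpow /= mulrA.
have lu : Lp 1 (horner u) by apply: Loo_Lp => //; exact: Loo_horner.
have lt : Lp 1 (cpow (k%:Z - 1) \* tilde (horner u)).
  by apply: LpM => //; [exact: Loo_cpow|exact: Lp_tilde].
have [|r rE] := @usum_span R e s k signature_es2 u uk.
  move=> i ik.
  have := fourier_ae i%:Z (Lp_meas lu) (Lp_meas (LpZ (e * s) ltr01 lt)) usym.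
  rewrite fourierZ// fourier_shift fourier_tilde// !fourier_horner => ->.
  by rewrite (_ : - (i%:Z - (k%:Z - 1)) = (k.-1 - i)%N); [|lia].
by exists r; rewrite -rE.
Qed.

End flip_symmetry.

(** * Matching pairs *)

Section matching.
Context {R : realType} (P : cfun R -> cfun R) (hP : riesz_projection P).
Context (p : R) (hp : 1 < p) (a b : cfun R) (hab : matching_pair a b).
Implicit Types (f : cfun R).

Lemma matching_ae : {ae arc, forall x, [/\ a (cis x) != 0, a (cis x)^-1 != 0,
  b (cis x) != 0, b (cis x)^-1 != 0 & a (cis x) * a (cis x)^-1 = b (cis x) * b (cis x)^-1]}.
Proof.
have [_ _ [_ aV] ab] := hab.
have nza : {ae arc, forall x, a (cis x) != 0}.
  apply: filterS aV => x; rewrite /cinv /cone /= => h; apply/eqP => h0.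
  by move: h; rewrite h0 mul0r => /eqP; rewrite eq_sym oner_eq0.
have nzt : {ae arc, forall x, a (cis x)^-1 != 0}.
  by apply: filterS (@ae_refl_angle R _ nza) => x; rewrite cis_refl_angle.
apply: filterS3 nza nzt ab => x h1 h2; rewrite /tilde /= => h3.
have : b (cis x) * b (cis x)^-1 != 0 by rewrite -h3 mulf_neq0.
by rewrite mulf_eq0 negb_or => /andP[].
Qed.

Lemma Loo_a : Lp +oo%E a. Proof. by case: hab. Qed.
Lemma Loo_b : Lp +oo%E b. Proof. by case: hab. Qed.

Lemma Loo_at : Lp +oo%E (cinv (tilde a)).
Proof. by have [_ _ [h _] _] := hab; exact: (Loo_tilde h). Qed.

(** The matching condition expresses 1/b as (b o 1/t) / (a (a o 1/t)). *)
Lemma Loo_bV : Lp +oo%E (cinv b).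
Proof.
have [_ lb [lV _] _] := hab.
have /LooP[_ [M M0 hM]] : Lp +oo%E (tilde b \* (cinv a \* tilde (cinv a))).
  by apply: LooM; [exact: Loo_tilde|apply: LooM => //; exact: Loo_tilde].
apply/LooP; split; first exact: cmeasV (Lp_meas lb).
exists M => //; apply: filterS2 hM matching_ae => x hx [a0 a1 b0 b1 e].
rewrite (_ : cinv b _ = (tilde b \* (cinv a \* tilde (cinv a))) (cis x))//.
rewrite /cinv /tilde /=; apply: (mulfI b0); rewrite mulfV// [RHS]mulrA -e.
by field; rewrite a0 a1.
Qed.

Lemma Loo_c : Lp +oo%E (sub_c a b).
Proof. by apply: LooM; [exact: Loo_a|exact: Loo_bV]. Qed.

Lemma Loo_d : Lp +oo%E (sub_d a b).
Proof. by apply: LooM; [exact: Loo_b|exact: Loo_at]. Qed.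

Lemma sub_c_tilde : ae_circle (sub_c a b \* tilde (sub_c a b)) cone.
Proof.
apply: filterS matching_ae => x [a0 a1 b0 b1 e].
by rewrite /sub_c /tilde /cinv /cone /= mulrACA e -invfM mulfV ?mulf_neq0.
Qed.

Lemma sub_d_tilde : ae_circle (sub_d a b \* tilde (sub_d a b)) cone.
Proof.
apply: filterS matching_ae => x [a0 a1 b0 b1 e].
by rewrite /sub_d /tilde /cinv /cone /= invrK mulrACA -e -invfM mulrC [a _^-1 * _]mulrC
  mulVf ?mulf_neq0.
Qed.

(** With C = (c chi - (a o 1/t)^-1 psi), which has only negative frequencies by
    assumption, phi = chi - J C. Then a phi + b J phi = a chi + b J chi - a J C
    - b C, in which the terms in chi cancel because b c = a and a (c o 1/t) = b.
    The function chi' is chi or P chi, according to where the computation is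
    used. *)
Lemma th_sum_particular psi chi chi' :
  Hp p psi -> Hp p chi -> Lp p%:E chi' -> ae_circle chi' chi ->
  (forall n : int, 0 <= n -> fourier (sub_c a b \* chi) n = fourier (cinv (tilde a) \* psi) n) ->
  let phi := chi \- flip (Qproj P (sub_c a b \* chi')) \+ flip (Qproj P (cinv (tilde a) \* psi)) in
  Hp p phi /\ ae_circle (th_sum a b phi) (flip psi \+ (sub_d a b \* psi)).
Proof.
move=> hpsi hchi lchi' cc fE phi.
have p0 : 0 < p by exact: lt_trans hp.
have l1 : Lp p%:E (sub_c a b \* chi') by apply: LpM => //; exact: Loo_c.
have l1' : Lp p%:E (sub_c a b \* chi) by apply: LpM => //; [exact: Loo_c|case: hchi].
have l2 : Lp p%:E (cinv (tilde a) \* psi) by apply: LpM => //; [exact: Loo_at|case: hpsi].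
split.
  apply: Hp_D => //; last exact: Hp_flipQ.
  by apply: Hp_B => //; exact: Hp_flipQ.
have PE : ae_circle (P (sub_c a b \* chi')) (P (cinv (tilde a) \* psi)).
  apply: (P_eq hP hp) => //; first exact: P_Lp.
  move=> n; rewrite (fourier_P hP _ hp l2); case: (leP 0 n) => // n0.
  rewrite -fE//; apply: fourier_ae; [exact: Lp_meas l1'|exact: Lp_meas l1|].
  by apply: filterS cc => x /= ->.
have phiE : {ae arc, forall x, phi (cis x) = chi (cis x) -
    (cis x)^-1 * (a (cis x)^-1 / b (cis x)^-1 * chi (cis x)^-1 - (a (cis x))^-1 * psi (cis x)^-1)}.
  apply: filterS2 (ae_tilde PE) (ae_tilde cc) => x; rewrite /tilde => h1 h2.
  by rewrite /phi /flip /Qproj /sub_c /cinv /tilde /= in h1 *; rewrite h1 h2 invrK; ring.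
have phiEt : {ae arc, forall x, phi (cis x)^-1 = chi (cis x)^-1 -
    cis x * (a (cis x) / b (cis x) * chi (cis x) - (a (cis x)^-1)^-1 * psi (cis x))}.
  by apply: filterS (@ae_refl_angle R _ phiE) => x; rewrite cis_refl_angle invrK.
apply: filterS3 phiE phiEt matching_ae => x h1 h2 [a0 a1 b0 b1 e].
rewrite /th_sum /flip /sub_d /cinv /tilde /= h1 h2; have t0 := cis_neq0 x.
have bE : b (cis x) = a (cis x) * a (cis x)^-1 / b (cis x)^-1 by rewrite e mulfK.
move: b1; rewrite bE; move: (b (cis x)^-1) => B B0.
by field; rewrite t0 a0 a1 B0.
Qed.

End matching.

(** At k = 0, where sgn(k) = 0, the sum has no terms. *)
Lemma sgz_usum {R : realType} (k : nat) (e s : R[i]) (r : 'I_(nb_terms k) -> R[i]) :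
  ((sgz k%:Z)%:~R : R[i]) = 1 \/
  ((sgz k%:Z)%:~R : R[i]) = 0 /\ forall t, usum e s r t = 0.
Proof.
case: k r => [|k] r; [right|by left].
by split=> // t; rewrite /usum /lincomb big1// => -[].
Qed.

(** * Solutions of the equation *)

Section solutions.
Context {R : realType} (P : cfun R -> cfun R) (hP : riesz_projection P).
Context (p q : R) (hp : 1 < p) (hpq : p^-1 + q^-1 = 1).
Context (a b : cfun R) (hab : matching_pair a b) (kc kd : nat).
Context (Fc : wh_factorization P p q (sub_c a b) (- kc%:Z)).
Context (Fd : wh_factorization P p q (sub_d a b) (- kd%:Z)).
Implicit Types (f phi psi : cfun R) (n : int).

Let la := Loo_a hab. Let lb := Loo_b hab. Let lat := Loo_at hab.
Let lc := Loo_c hab. Let ld := Loo_d hab.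
Let cc := sub_c_tilde hab. Let dd := sub_d_tilde hab.

(** The function chi with T(c) chi = T((a o 1/t)^-1) psi common to W and to the
    particular solution. *)
Definition chi_of psi : cfun R := Tr_inv Fc (toeplitz P (cinv (tilde a)) psi).

Lemma chi_of_Hp psi : Hp p psi -> Hp p (chi_of psi).
Proof. by move=> h; apply: Tr_inv_Hp => //; exact: toeplitz_Hp. Qed.

Lemma fourier_chi_of psi n : Hp p psi -> 0 <= n ->
  fourier (sub_c a b \* chi_of psi) n = fourier (cinv (tilde a) \* psi) n.
Proof.
move=> h n0; rewrite /chi_of (fourier_Tr_inv hP hp hpq)//; last exact: toeplitz_Hp.
by rewrite (fourier_toeplitz hP hp).
Qed.

Definition particular psi : cfun R :=
  chi_of psi \- flip (Qproj P (sub_c a b \* chi_of psi))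
  \+ flip (Qproj P (cinv (tilde a) \* psi)).

Lemma particular_spec psi : Hp p psi -> Hp p (particular psi) /\
  ae_circle (th_sum a b (particular psi)) (flip psi \+ (sub_d a b \* psi)).
Proof.
move=> h; have hchi := chi_of_Hp h.
apply: (th_sum_particular hP hp hab h hchi hchi.1); first exact: aeW.
by move=> n n0; rewrite fourier_chi_of.
Qed.

Lemma Wop_spec psi : Hp p psi -> Hp p (Wop a Fc psi) /\
  ae_circle (th_sum a b (Wop a Fc psi)) (flip psi \+ (sub_d a b \* psi)).
Proof.
move=> h; have hchi := chi_of_Hp h.
apply: (th_sum_particular hP hp hab h hchi (P_Lp hP hp hchi.1) (P_Hp hP hp hchi)).
by move=> n n0; rewrite fourier_chi_of.
Qed.

Definition c_kernel_part (r : 'I_(nb_terms kc) -> R[i]) : cfun R :=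
  cscale (sgz kc%:Z)%:~R (cinv (wh_plus Fc) \* usum (-1) (signature Fc) r).

Lemma c_kernel_partE r t :
  c_kernel_part r t = (cinv (wh_plus Fc) \* usum (-1) (signature Fc) r) t.
Proof.
rewrite /c_kernel_part /cscale /=.
by case: (sgz_usum (-1) (signature Fc) r) => [->|[-> ->]]; rewrite ?mul1r ?mulr0.
Qed.

Let m1sq : (-1 : R[i]) ^+ 2 = 1. Proof. by rewrite sqrrN expr1n. Qed.
Let p1sq : (1 : R[i]) ^+ 2 = 1. Proof. by rewrite expr1n. Qed.

Lemma c_kernel_part_spec r : Hp p (c_kernel_part r) /\
  ae_circle (th_sum a b (c_kernel_part r)) czero.
Proof.
have -> : c_kernel_part r = cinv (wh_plus Fc) \* usum (-1) (signature Fc) r.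
  by apply/funext => t; rewrite c_kernel_partE.
split; first by rewrite usumE; exact: Hp_wh_poly.
apply: filterS2 (flip_wh_usum hp hpq Fc cc m1sq r) (matching_ae hab) => x e1 [_ _ b0 _ _].
rewrite /th_sum /= e1 /cscale /sub_c /cinv /czero /=.
by rewrite mulN1r mulrN !mulrA (mulrC (b _)) mulfK // subrr.
Qed.

Definition d_kernel_fun (r : 'I_(nb_terms kd) -> R[i]) : cfun R :=
  cinv (wh_plus Fd) \* usum 1 (signature Fd) r.

Lemma d_kernel_fun_Hp r : Hp p (d_kernel_fun r).
Proof. by rewrite /d_kernel_fun usumE; exact: Hp_wh_poly. Qed.

Lemma d_kernel_fun_flip r : ae_circle (flip (d_kernel_fun r)) (sub_d a b \* d_kernel_fun r).
Proof.
apply: filterS (flip_wh_usum hp hpq Fd dd p1sq r) => x.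
by rewrite /cscale mul1r.
Qed.

Definition d_kernel_part (r : 'I_(nb_terms kd) -> R[i]) : cfun R :=
  cscale (sgz kd%:Z)%:~R (Wop a Fc (d_kernel_fun r)).

Lemma d_kernel_part_spec r : Hp p (d_kernel_part r) /\
  ae_circle (th_sum a b (d_kernel_part r)) (cscale 2 (flip (d_kernel_fun r))).
Proof.
have hpsi := d_kernel_fun_Hp r.
have [hW eW] := Wop_spec hpsi.
split; first exact: Hp_Z.
apply: filterS2 eW (d_kernel_fun_flip r) => x.
rewrite /th_sum /d_kernel_part /cscale /flip /d_kernel_fun /=.
case: (sgz_usum 1 (signature Fd) r) => [->|[-> u0]].
  by rewrite !mul1r => -> <-; rewrite mulr_natl mulr2n.
by rewrite !u0 => _ _; rewrite !mul0r !mulr0 addr0.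
Qed.

Lemma solutionE f r1 r2 : solution Fc Fd f r1 r2 =
  particular (Tr_inv Fd f) \+ c_kernel_part r1 \+ d_kernel_part r2.
Proof. by []. Qed.

Lemma th_sumD phi psi t :
  th_sum a b (phi \+ psi) t = th_sum a b phi t + th_sum a b psi t.
Proof. by rewrite /th_sum /flip /=; ring. Qed.

Lemma th_sumB phi psi t :
  th_sum a b (phi \- psi) t = th_sum a b phi t - th_sum a b psi t.
Proof. by rewrite /th_sum /flip /=; ring. Qed.

Lemma particular_Tr_inv f n : Hp p f -> 0 <= n ->
  fourier (th_sum a b (particular (Tr_inv Fd f))) n = fourier f n.
Proof.
move=> hf n0.
have hpsi : Hp p (Tr_inv Fd f) by exact: Tr_inv_Hp.
have [hB eB] := particular_spec hpsi.
have l1 : Lp p%:E (flip (Tr_inv Fd f)) by apply: flip_Lp => //; case: hpsi.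
have l2 : Lp p%:E (sub_d a b \* Tr_inv Fd f).
  by apply: LpM => //; [exact: lt_trans hp|case: hpsi].
have l1p := ltW hp.
rewrite (fourier_ae n _ _ eB); last 2 first.
- exact: Lp_meas (th_sum_Lp hp la lb hB.1).
- exact: Lp_meas (LpD l1p l1 l2).
rewrite fourierD; [|exact: Lp_L1 l1p l1|exact: Lp_L1 l1p l2].
by rewrite (fourier_flip_Hp hp hpsi)// add0r (fourier_Tr_inv hP hp hpq).
Qed.

Lemma solution_solves f r1 r2 : Hp p f -> Hp p (solution Fc Fd f r1 r2) /\
  ae_circle (toeplitz P a (solution Fc Fd f r1 r2) \+ hankel P b (solution Fc Fd f r1 r2)) f.
Proof.
move=> hf; rewrite solutionE.
have hpsi : Hp p (Tr_inv Fd f) by exact: Tr_inv_Hp.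
have [hB _] := particular_spec hpsi.
have [hC eC] := c_kernel_part_spec r1; have [hD eD] := d_kernel_part_spec r2.
have hBC : Hp p (particular (Tr_inv Fd f) \+ c_kernel_part r1) by exact: Hp_D.
have hS : Hp p (particular (Tr_inv Fd f) \+ c_kernel_part r1 \+ d_kernel_part r2) by exact: Hp_D.
split => //; apply/(th_sumP hP hp la lb hS hf) => n n0.
have l1p := ltW hp.
have lB := th_sum_Lp hp la lb hB.1; have lS := th_sum_Lp hp la lb hS.1.
have lflip : Lp p%:E (flip (d_kernel_fun r2)).
  by apply: flip_Lp => //; case: (d_kernel_fun_Hp r2).
have l2 : Lp p%:E (cscale 2 (flip (d_kernel_fun r2))).
  by apply: LpZ => //; exact: lt_trans hp.
have eS : ae_circle (th_sum a b (particular (Tr_inv Fd f) \+ c_kernel_part r1 \+ d_kernel_part r2))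
    (th_sum a b (particular (Tr_inv Fd f)) \+ cscale 2 (flip (d_kernel_fun r2))).
  by apply: filterS2 eC eD => x e1 e2; rewrite 2!th_sumD e1 e2 /czero /= addr0.
rewrite (fourier_ae n (Lp_meas lS) (Lp_meas (LpD l1p lB l2)) eS).
rewrite fourierD; [|exact: Lp_L1 l1p lB|exact: Lp_L1 l1p l2].
rewrite particular_Tr_inv// fourierZ; last exact: Lp_L1 l1p lflip.
by rewrite (fourier_flip_Hp hp (d_kernel_fun_Hp r2))// mulr0 addr0.
Qed.

(** Put eta = J (a delta + b J delta), an element of H^p; the matching condition
    gives d eta = J eta, so eta / 2 is d_+^-1 times a symmetric polynomial. Its
    image E under W satisfies a E + b J E = 2 J (eta / 2) = a delta + b J delta,
    hence chi0 = delta - E satisfies a chi0 + b J chi0 = 0, that is, J chi0 =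
    - c chi0, and chi0 is c_+^-1 times an antisymmetric polynomial. *)
Lemma homogeneous_solution delta : Hp p delta ->
  (forall n, 0 <= n -> fourier (th_sum a b delta) n = 0) ->
  exists r1 r2, ae_circle delta (c_kernel_part r1 \+ d_kernel_part r2).
Proof.
move=> hdelta h0; have l1p := ltW hp.
have lE := th_sum_Lp hp la lb hdelta.1.
pose eta := flip (th_sum a b delta).
have heta : Hp p eta by exact: Hp_flip.
have lfeta : Lp p%:E (flip eta) by apply: flip_Lp => //; case: heta.
have feta : ae_circle (flip eta) (th_sum a b delta) by apply: aeW => x; exact: flipKE.
have deta : ae_circle (sub_d a b \* eta) (flip eta).
  apply: filterS (matching_ae hab) => x [a0 a1 b0 b1 e].
  rewrite /eta flipKE /th_sum /flip /sub_d /cinv /tilde /= invrK.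
  have t0 := cis_neq0 x.
  have aE : a (cis x) = b (cis x) * b (cis x)^-1 / a (cis x)^-1 by rewrite -e mulfK.
  rewrite [in RHS]aE; move: (b (cis x)^-1) (a (cis x)^-1) a1 => B A A0.
  by field; rewrite A0 t0.
have lde : Lp p%:E (sub_d a b \* eta).
  by apply: LpM => //; [exact: lt_trans hp|case: heta].
have deta0 n : 0 <= n -> fourier (sub_d a b \* eta) n = 0.
  move=> n0; rewrite (fourier_ae n (Lp_meas lde) (Lp_meas lfeta) deta).
  exact: (fourier_flip_Hp hp heta n0).
have hhalf : Hp p (cscale 2^-1 eta) by exact: Hp_Z.
have [] := @wh_kernel_usum R P p q hp hpq (sub_d a b) ld kd Fd dd 1 p1sq (cscale 2^-1 eta) hhalf.
- move=> n n0; rewrite (_ : sub_d a b \* _ = cscale 2^-1 (sub_d a b \* eta)).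
    by rewrite fourierZ ?deta0 ?mulr0//; exact: Lp_L1 l1p lde.
  by apply/funext => t; rewrite /cscale /= mulrCA.
- apply: filterS deta => x; rewrite /flip /cscale /= mul1r => h.
  by rewrite mulrCA -h mulrCA.
move=> r2 eta2.
have [hD eD] := d_kernel_part_spec r2.
pose chi0 := delta \- d_kernel_part r2.
have hchi0 : Hp p chi0 by exact: Hp_B.
have two0 : (2 : R[i]) != 0 by rewrite pnatr_eq0.
have chi00 : ae_circle (th_sum a b chi0) czero.
  apply: filterS3 eD feta (ae_flip eta2) => x e1 e2 e3.
  rewrite /chi0 th_sumB e1 -e2 /cscale -/(d_kernel_fun r2) in e3 *.
  by rewrite -e3 /flip /czero; field; exact: cis_neq0.
have fchi0 : ae_circle (flip chi0) (cscale (-1) (sub_c a b \* chi0)).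
  apply: filterS2 chi00 (matching_ae hab) => x; rewrite /th_sum /czero /= => h [_ _ b0 _ _].
  have hb : b (cis x) * flip chi0 (cis x) = - (a (cis x) * chi0 (cis x)).
    by apply/eqP; rewrite -addr_eq0 addrC; apply/eqP.
  apply: (mulfI b0); rewrite hb /cscale /sub_c /cinv /=.
  by move: (chi0 (cis x)) => z; field.
have lc0 : Lp p%:E (sub_c a b \* chi0).
  by apply: LpM => //; [exact: lt_trans hp|case: hchi0].
have lf0 : Lp p%:E (flip chi0) by apply: flip_Lp => //; case: hchi0.
have lfm : Lp p%:E (cscale (-1) (sub_c a b \* chi0)) by apply: LpZ => //; exact: lt_trans hp.
have [] := @wh_kernel_usum R P p q hp hpq (sub_c a b) lc kc Fc cc (-1) m1sq chi0 hchi0.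
- move=> n n0; have := fourier_ae n (Lp_meas lf0) (Lp_meas lfm) fchi0.
  rewrite (fourier_flip_Hp hp hchi0)// fourierZ; last exact: Lp_L1 l1p lc0.
  by rewrite mulN1r => /eqP; rewrite eq_sym oppr_eq0 => /eqP.
- exact: fchi0.
move=> r1 chi1; exists r1, r2; apply: filterS chi1 => x.
by rewrite /chi0 /= c_kernel_partE => /= <-; rewrite subrK.
Qed.

Lemma solution_complete f phi : Hp p f -> Hp p phi ->
  ae_circle (toeplitz P a phi \+ hankel P b phi) f ->
  exists r1 r2, ae_circle phi (solution Fc Fd f r1 r2).
Proof.
move=> hf hphi /(th_sumP hP hp la lb hphi hf) phiE.
have hpsi : Hp p (Tr_inv Fd f) by exact: Tr_inv_Hp.
have [hB _] := particular_spec hpsi; have l1p := ltW hp.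
have hdelta : Hp p (phi \- particular (Tr_inv Fd f)) by exact: Hp_B.
have lphi := th_sum_Lp hp la lb hphi.1; have lB := th_sum_Lp hp la lb hB.1.
have [n n0|r1 [r2 h]] := homogeneous_solution hdelta.
  rewrite (@fourier_eq _ _ (th_sum a b phi \- th_sum a b (particular (Tr_inv Fd f)))).
    rewrite fourierB; [|exact: Lp_L1 l1p lphi|exact: Lp_L1 l1p lB].
    by rewrite particular_Tr_inv// phiE// subrr.
  by move=> x; rewrite th_sumB.
exists r1, r2; rewrite solutionE; apply: filterS h => x /= h.
by rewrite -addrA -h addrC subrK.
Qed.

End solutions.

Theorem theorem3p2 (R : realType) (p q : R) (hp : 1 < p)
  (hpq : p^-1 + q^-1 = 1)
  (P : cfun R -> cfun R) (hP : riesz_projection P)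
  (a b : cfun R) (hab : matching_pair a b)
  (kc kd : int)
  (hc : fredholm_index p (toeplitz P (sub_c a b)) kc)
  (hd : fredholm_index p (toeplitz P (sub_d a b)) kd)
  (Fc : wh_factorization P p q (sub_c a b) (- kc))
  (Fd : wh_factorization P p q (sub_d a b) (- kd))
  (hkc : 0 <= kc) (hkd : 0 <= kd)
  (f : cfun R) (hf : Hp p f) :
  (exists phi : cfun R, Hp p phi /\
     ae_circle (toeplitz P a phi \+ hankel P b phi) f) /\
  (forall (r1 : 'I_(nb_terms `|kc|) -> R[i])
          (r2 : 'I_(nb_terms `|kd|) -> R[i]),
     Hp p (solution Fc Fd f r1 r2) /\
     ae_circle (toeplitz P a (solution Fc Fd f r1 r2)
                \+ hankel P b (solution Fc Fd f r1 r2)) f) /\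
  (forall phi : cfun R, Hp p phi ->
     ae_circle (toeplitz P a phi \+ hankel P b phi) f ->
     exists (r1 : 'I_(nb_terms `|kc|) -> R[i])
            (r2 : 'I_(nb_terms `|kd|) -> R[i]),
       ae_circle phi (solution Fc Fd f r1 r2)).
Proof.
case: kc hkc hc Fc => // kc _ _ Fc; case: kd hkd hd Fd => // kd _ _ Fd.
split; last split.
- exists (solution Fc Fd f (fun=> 0) (fun=> 0)).
  exact: (solution_solves hP hp hpq hab Fc Fd).
- by move=> r1 r2; exact: (solution_solves hP hp hpq hab Fc Fd).
- by move=> phi; exact: (solution_complete hP hp hpq hab Fc Fd).
Qed.
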